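(* Let $\eta>0$. There are constants $a=a(\eta)>0$ and $N_0=N_0(\eta)$ such that for every finite abelian group $G$ of order $N\ge N_0$ there is a complex $N\times N$ matrix $B_G$ satisfying $$ \operatorname{rank} B_G\le N^{1-a}\qquad\text{and}\qquad \|\mathcal F_G-B_G\|_{1,\infty}\le N^{1/2+\eta}. $$
   Context: For a finite abelian group $G$ fix a non-degenerate symmetric pairing $G\times G\to\mathbb R/\mathbb Z$, $(x,y)\mapsto x\cdot y$ (bi-additive), identifying $G$ with its dual. The Fourier matrix is $\mathcal F_G:=(e^{2\pi i\,x\cdot y})_{x,y\in G}$; changing the pairing only permutes rows and columns. For an $N\times N$ matrix $A$, $$\|A\|_{1,\infty}:=\max_{i}\sum_{j}|A_{i,j}|.$$ *)

(* Defs.v *)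
From HB Require Import structures.
From mathcomp Require Import all_boot all_order all_algebra.
From mathcomp Require Import generic_quotient ring_quotient complex.
From mathcomp Require Import all_classical all_reals all_analysis.

Set Implicit Arguments.
Unset Strict Implicit.
Unset Printing Implicit Defensive.

Import Order.TTheory GRing.Theory Num.Theory.

#[local] Open Scope ring_scope.
#[local] Open Scope quotient_scope.
#[local] Open Scope complex_scope.

Definition int_zmod (R : realType) : zmodClosed R :=
  GRing.ZmodClosed.clone R (@Num.int_num_subdef R) _.

Definition RmodZ (R : realType) : zmodType := Quotient.quot (int_zmod R).

(* z |-> e^{2 pi i z} on R/Z, computed on the canonical representative of z;
   by [exp2piiE] any representative gives the same value. *)
Definition exp2pii (R : realType) (z : RmodZ R) : R[i] :=
  cos (2 * pi * repr z) +i* sin (2 * pi * repr z).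

Lemma periodicz (R : realType) (f : R -> R) (T : R) :
  periodic f T -> forall (k : int) a, f (a + T *~ k) = f a.
Proof.
move=> pf [n|n] a; first exact: periodicn.
by rewrite -[in RHS](subrK (T *+ n.+1) a) periodicn.
Qed.

Lemma exp2piiE (R : realType) (t : R) :
  exp2pii (\pi_(RmodZ R) t) = cos (2 * pi * t) +i* sin (2 * pi * t).
Proof.
rewrite /exp2pii; set u := repr _.
have /intrP[k uE] : u - t \is a Num.int.
  rewrite -[_ \is a _]/(_ - _ \in int_zmod R).
  by rewrite Quotient.idealrBE reprK.
have -> : 2 * pi * u = 2 * pi * t + (pi *+ 2) *~ k.
  by rewrite -[u](subrK t) uE mulrDr addrC mulrzr mulr2n mulrDl mul1r.
by rewrite (periodicz (@cosD2pi R)) (periodicz (@sinD2pi R)).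
Qed.

Definition nondeg_sym_pairing (R : realType) (G : finZmodType)
    (b : G -> G -> RmodZ R) : Prop :=
  [/\ forall x y z, b (x + y) z = b x z + b y z,
      forall x y z, b x (y + z) = b x y + b x z,
      forall x y, b x y = b y x
    & forall x, (forall y, b x y = 0) -> x = 0].

(* Rows and columns are indexed by G, numbered by [enum_val]. *)
Definition fourier_mx (R : realType) (G : finZmodType)
    (b : G -> G -> RmodZ R) : 'M[R[i]]_#|G| :=
  \matrix_(i, j) exp2pii (b (enum_val i) (enum_val j)).

Definition norm_1oo (R : realType) (n : nat) (A : 'M[R[i]]_n) : R :=
  \big[Num.max/0]_(i < n) \sum_(j < n) Normc.normc (A i j).

(* Main.v *)
(* Split G into cyclic factors of bounded order and large cyclic factors.

   For a product of n groups of bounded order, F / sqrt N is a tensor product of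
   matrices U_t with U_t ^ 4 = 1, so it acts as i ^ w where w is a sum of n
   independent exponents. By concentration w lies in a window of length about
   2 e n on all but an exponentially small part of the space, and on that window
   i ^ w agrees with a polynomial of degree about 2 e n in the commuting U_t,
   whose row sums are N ^ O(e). Hence F is this polynomial, times sqrt N, plus a
   matrix of rank N ^ (1 - a).

   On a large cyclic group, e(x y / N) = u(x) u(y) e(- (x - y) ^ 2 / 2 N) reduces
   to a Toeplitz matrix. Writing integers in base r and each digit modulo several
   coprime moduli whose product is at least 2 r embeds it into a circulant
   F D F^* of a product of bounded groups. The embedding enlarges N by a factor
   exponential in the number of digits, but with m moduli per digit the rank
   saving is exponential in m times that number. Replacing F by its sparse part
   and discarding the few large entries of D gives the claim, and the two parts
   are combined by tensoring. *)

Require Import Defs.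
From HB Require Import structures.
From mathcomp Require Import all_boot all_order all_algebra.
From mathcomp Require Import all_fingroup all_solvable ring lra.
From mathcomp Require Import generic_quotient ring_quotient complex.
From mathcomp Require Import all_classical all_reals all_analysis.

Set Implicit Arguments.
Unset Strict Implicit.
Unset Printing Implicit Defensive.

Import Order.TTheory GRing.Theory Num.Theory.

#[local] Open Scope ring_scope.

Local Notation nc := (Normc.normc).

(** * Kernels on finite sets *)

Section Kernels.
Variable R : realType.
Local Notation C := R[i].
Implicit Types X Y Z : finType.

Lemma ncE (z : C) : `|z| = (nc z)%:C%C. Proof. by []. Qed.

Lemma nc_ge0 (z : C) : 0 <= nc z.
Proof. by rewrite -ler0c -ncE normr_ge0. Qed.

Lemma nc_le_add (x y : C) : nc (x + y) <= nc x + nc y.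
Proof. by rewrite -lecR rmorphD /= -!ncE ler_normD. Qed.

Lemma ncN (x : C) : nc (- x) = nc x.
Proof. by apply: complexI; rewrite -!ncE normrN. Qed.

Lemma ncJ (x : C) : nc (conjc x) = nc x.
Proof. by case: x => a b /=; rewrite sqrrN. Qed.

Lemma nc1 : nc (1 : C) = 1.
Proof. by rewrite -[1]/(1%:C%C) Normc.normc1. Qed.

Lemma ncX (x : C) n : nc (x ^+ n) = nc x ^+ n.
Proof.
elim: n => [|n IHn]; first by rewrite !expr0 nc1.
by rewrite !exprS Normc.normcM IHn.
Qed.

Lemma nc_real (x : R) : 0 <= x -> nc (x%:C%C) = x.
Proof. by move=> x0; rewrite /= expr0n addr0 sqrtr_sqr ger0_norm. Qed.

Lemma nc_nat n : nc (n%:R : C) = n%:R.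
Proof.
have -> : n%:R = (n%:R : R)%:C%C by rewrite rmorph_nat.
by rewrite nc_real.
Qed.

Lemma nc_sum (I : finType) (P : pred I) (f : I -> C) :
  nc (\sum_(i | P i) f i) <= \sum_(i | P i) nc (f i).
Proof.
elim/big_ind2: _ => [|x a y b ha hb|//]; first by rewrite Normc.normc0.
by apply: (le_trans (nc_le_add _ _)); rewrite lerD.
Qed.

Lemma mul_conjc (x : C) : x * conjc x = (nc x ^+ 2)%:C%C.
Proof.
case: x => a b /=; rewrite sqr_sqrtr ?addr_ge0 ?sqr_ge0 //.
by rewrite /GRing.mul /= mulrN opprK mulrN -!expr2 [b * a]mulrC addNr.
Qed.

Lemma sum_pair_mul (S : pzSemiRingType) X Y (f : X -> S) (g : Y -> S) :
  \sum_(z : X * Y) f z.1 * g z.2 = (\sum_x f x) * (\sum_y g y).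
Proof.
rewrite big_distrl /= -(pair_bigA _ (fun x y => f x * g y)) /=.
by apply: eq_bigr => x _; rewrite big_distrr.
Qed.

Lemma sum_delta X (S : pzSemiRingType) (x : X) (f : X -> S) :
  \sum_y (x == y)%:R * f y = f x.
Proof.
rewrite (bigD1 x) //= eqxx mul1r big1 ?addr0 // => y /negbTE.
by rewrite eq_sym => ->; rewrite mul0r.
Qed.

Definition kmul X Y Z (K : X -> Y -> C) (L : Y -> Z -> C) x z : C :=
  \sum_y K x y * L y z.

Definition tens X X' Y Y' (K : X -> Y -> C) (L : X' -> Y' -> C)
    (x : X * X') (y : Y * Y') : C := K x.1 y.1 * L x.2 y.2.

(* [rk_le] and [nrm_le] are kernel versions of the rank and of the larger of the
   maximal row and column sums; column sums are needed to bound adjoints. *)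
Definition rk_le X Y (K : X -> Y -> C) (r : R) : Prop :=
  exists (Z : finType) (u : X -> Z -> C) (v : Z -> Y -> C),
    #|Z|%:R <= r /\ forall x y, K x y = kmul u v x y.

Definition nrm_le X Y (K : X -> Y -> C) (c : R) : Prop :=
  (forall x, \sum_y nc (K x y) <= c) /\ (forall y, \sum_x nc (K x y) <= c).

Lemma eq_rk X Y (K L : X -> Y -> C) r :
  (forall x y, K x y = L x y) -> rk_le K r -> rk_le L r.
Proof.
by move=> KL [Z [u [v [hZ h]]]]; exists Z, u, v; split=> // x y; rewrite -KL.
Qed.

Lemma rk_leW X Y (K : X -> Y -> C) r s : r <= s -> rk_le K r -> rk_le K s.
Proof.
by move=> rs [Z [u [v [hZ h]]]]; exists Z, u, v; split=> //; apply: le_trans rs.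
Qed.

Lemma rk_leD X Y (K L : X -> Y -> C) r s :
  rk_le K r -> rk_le L s -> rk_le (fun x y => K x y + L x y) (r + s).
Proof.
move=> [Z [u [v [hZ h]]]] [Z' [u' [v' [hZ' h']]]].
exists (Z + Z')%type, (fun x z => match z with inl a => u x a | inr b => u' x b end),
  (fun z y => match z with inl a => v a y | inr b => v' b y end).
split=> [|x y]; first by rewrite card_sum natrD lerD.
by rewrite h h' /kmul big_sumType.
Qed.

Lemma rk_le_mulr X Y Z (K : X -> Y -> C) (L : Y -> Z -> C) r :
  rk_le K r -> rk_le (kmul K L) r.
Proof.
move=> [W [u [v [hW h]]]]; exists W, u, (kmul v L); split=> // x z.
rewrite /kmul; under eq_bigr do rewrite h /kmul mulr_suml.
rewrite exchange_big /=; apply: eq_bigr => w _; rewrite mulr_sumr.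
by apply: eq_bigr => y _; rewrite mulrA.
Qed.

Lemma rk_le_mull X Y Z (K : X -> Y -> C) (L : Y -> Z -> C) r :
  rk_le L r -> rk_le (kmul K L) r.
Proof.
move=> [W [u [v [hW h]]]]; exists W, (kmul K u), v; split=> // x z.
rewrite /kmul; under eq_bigr do rewrite h /kmul mulr_sumr.
rewrite exchange_big /=; apply: eq_bigr => w _; rewrite mulr_suml.
by apply: eq_bigr => y _; rewrite mulrA.
Qed.

Lemma rk_le_sub X Y X' Y' (f : X' -> X) (g : Y' -> Y) (K : X -> Y -> C) r :
  rk_le K r -> rk_le (fun x y => K (f x) (g y)) r.
Proof.
move=> [W [u [v [hW h]]]]; exists W, (fun x w => u (f x) w), (fun w y => v w (g y)).
by split=> // x y; rewrite h.
Qed.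

Lemma rk_le_scale X Y (a : X -> C) (b : Y -> C) (K : X -> Y -> C) r :
  rk_le K r -> rk_le (fun x y => a x * K x y * b y) r.
Proof.
move=> [W [u [v [hW h]]]].
exists W, (fun x w => a x * u x w), (fun w y => v w y * b y); split=> // x y.
by rewrite h /kmul mulr_sumr mulr_suml; apply: eq_bigr => w _; rewrite !mulrA.
Qed.

Lemma rk_le_tens X X' Y Y' (K : X -> Y -> C) (L : X' -> Y' -> C) r s :
  rk_le K r -> rk_le L s -> rk_le (tens K L) (r * s).
Proof.
move=> [Z [u [v [hZ h]]]] [Z' [u' [v' [hZ' h']]]].
exists (Z * Z')%type, (tens u u'), (tens v v'); split=> [|x y].
  by rewrite card_prod natrM ler_pM.
rewrite /tens h h' /kmul -(sum_pair_mul (fun z => u x.1 z * v z y.1)).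
by apply: eq_bigr => z _; rewrite mulrACA.
Qed.

Lemma rk_le_card X Y (K : X -> Y -> C) : rk_le K #|X|%:R.
Proof.
exists X, (fun x z => (x == z)%:R), K; split=> // x y.
by rewrite /kmul sum_delta.
Qed.

(** The diagonal vanishes off [P], so the intermediate index can be restricted to [P]. *)
Lemma rk_le_diag X Y Z (A : X -> Z -> C) (d : Z -> C) (B : Z -> Y -> C)
    (P : pred Z) :
  (forall z, ~~ P z -> d z = 0) ->
  rk_le (fun x y => \sum_z A x z * d z * B z y) #|P|%:R.
Proof.
move=> Pd; exists 'I_#|P|, (fun x i => A x (enum_val i) * d (enum_val i)),
  (fun i y => B (enum_val i) y); split=> [|x y]; first by rewrite card_ord.
rewrite /kmul -(big_enum_val (fun z => A x z * d z * B z y)) [LHS](bigID P) /=.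
rewrite [X in _ + X]big1 ?addr0 // => z /Pd ->.
by rewrite mulr0 mul0r.
Qed.

Lemma nrm_leW X Y (K : X -> Y -> C) c d : c <= d -> nrm_le K c -> nrm_le K d.
Proof. by move=> cd [h1 h2]; split=> z; apply: le_trans cd. Qed.

Lemma eq_nrm X Y (K L : X -> Y -> C) c :
  (forall x y, K x y = L x y) -> nrm_le K c -> nrm_le L c.
Proof.
move=> KL [h1 h2]; split=> z.
  by under eq_bigr do rewrite -KL.
by under eq_bigr do rewrite -KL.
Qed.

Lemma nrm_leD X Y (K L : X -> Y -> C) c d :
  nrm_le K c -> nrm_le L d -> nrm_le (fun x y => K x y + L x y) (c + d).
Proof.
move=> [h1 h2] [k1 k2]; split=> z.
  apply: (le_trans _ (lerD (h1 z) (k1 z))); rewrite -big_split /=.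
  by apply: ler_sum => y _; apply: nc_le_add.
apply: (le_trans _ (lerD (h2 z) (k2 z))); rewrite -big_split /=.
by apply: ler_sum => y _; apply: nc_le_add.
Qed.

Lemma nrm_le0 X Y : nrm_le (fun (_ : X) (_ : Y) => 0 : C) 0.
Proof. by split=> z; rewrite big1 // => y _; rewrite Normc.normc0. Qed.

Lemma nrm_le_sum X Y (I : Type) (r : seq I) (K : I -> X -> Y -> C) (c : I -> R) :
  (forall i, nrm_le (K i) (c i)) ->
  nrm_le (fun x y => \sum_(i <- r) K i x y) (\sum_(i <- r) c i).
Proof.
move=> h; elim: r => [|i r IHr].
  rewrite big_nil; apply: eq_nrm (nrm_le0 _ _) => x y; by rewrite big_nil.
rewrite big_cons; apply: eq_nrm (nrm_leD (h i) IHr) => x y.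
by rewrite big_cons.
Qed.

Lemma nrm_leZ X Y (a : C) (K : X -> Y -> C) c :
  nrm_le K c -> nrm_le (fun x y => a * K x y) (nc a * c).
Proof.
move=> [h1 h2]; split=> z; under eq_bigr do rewrite Normc.normcM.
  by rewrite -mulr_sumr ler_wpM2l // nc_ge0.
by rewrite -mulr_sumr ler_wpM2l // nc_ge0.
Qed.

Lemma nrm_le_id X : nrm_le (fun x y : X => (x == y)%:R : C) 1.
Proof.
split=> z; rewrite (bigD1 z) //= eqxx nc1 big1 ?addr0 //.
  by move=> y /negbTE; rewrite eq_sym => ->; rewrite Normc.normc0.
by move=> y /negbTE ->; rewrite Normc.normc0.
Qed.

Lemma nrm_le_mul X Y Z (K : X -> Y -> C) (L : Y -> Z -> C) c d :
  0 <= c -> 0 <= d ->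
  nrm_le K c -> nrm_le L d -> nrm_le (kmul K L) (c * d).
Proof.
move=> c0 d0 [h1 h2] [k1 k2]; split=> t.
  have : \sum_z \sum_y nc (K t y) * nc (L y z) <= c * d.
    rewrite exchange_big /= (le_trans _ (ler_wpM2r d0 (h1 t))) // mulr_suml.
    by apply: ler_sum => y _; rewrite -mulr_sumr ler_wpM2l ?nc_ge0.
  apply: le_trans; apply: ler_sum => z _; apply: (le_trans (nc_sum _ _)).
  by apply: ler_sum => y _; rewrite Normc.normcM.
have : \sum_x \sum_y nc (K x y) * nc (L y t) <= c * d.
  rewrite exchange_big /= (le_trans _ (ler_wpM2l c0 (k2 t))) // mulr_sumr.
  by apply: ler_sum => y _; rewrite -mulr_suml ler_wpM2r ?nc_ge0.
apply: le_trans; apply: ler_sum => z _; apply: (le_trans (nc_sum _ _)).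
by apply: ler_sum => y _; rewrite Normc.normcM.
Qed.

Lemma nrm_le_tens X X' Y Y' (K : X -> Y -> C) (L : X' -> Y' -> C) c d :
  nrm_le K c -> nrm_le L d -> nrm_le (tens K L) (c * d).
Proof.
move=> [h1 h2] [k1 k2]; split=> t; under eq_bigr do rewrite /tens Normc.normcM.
  rewrite (sum_pair_mul (fun z => nc (K t.1 z)) (fun z => nc (L t.2 z))).
  by rewrite ler_pM // sumr_ge0 // => *; rewrite nc_ge0.
rewrite (sum_pair_mul (fun z => nc (K z t.1)) (fun z => nc (L z t.2))).
by rewrite ler_pM // sumr_ge0 // => *; rewrite nc_ge0.
Qed.

Lemma ler_sum_inj X Y (f : X -> Y) (g : Y -> R) : injective f ->
  (forall y, 0 <= g y) -> \sum_x g (f x) <= \sum_y g y.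
Proof.
move=> fi g0; rewrite -(big_imset (A := X) g (in2W fi)) /=.
by rewrite [leRHS](bigID [in [set f x | x in X]]) /= lerDl sumr_ge0.
Qed.

(** Injectivity prevents a repeated row or column from being counted twice in the sums. *)
Lemma nrm_le_sub X Y X' Y' (f : X' -> X) (g : Y' -> Y) (K : X -> Y -> C) c :
  injective f -> injective g ->
  nrm_le K c -> nrm_le (fun x y => K (f x) (g y)) c.
Proof.
move=> fi gi [h1 h2]; split=> z.
  apply: le_trans (h1 (f z)).
  by apply: (ler_sum_inj (g := fun y => nc (K (f z) y)) gi) => y; apply: nc_ge0.
apply: le_trans (h2 (g z)).
by apply: (ler_sum_inj (g := fun y => nc (K y (g z))) fi) => y; apply: nc_ge0.
Qed.

Lemma nrm_le_scale X Y (a : X -> C) (b : Y -> C) (K : X -> Y -> C) c :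
  (forall x, nc (a x) = 1) -> (forall y, nc (b y) = 1) ->
  nrm_le K c -> nrm_le (fun x y => a x * K x y * b y) c.
Proof.
move=> ha hb [h1 h2]; split=> z.
  by under eq_bigr do rewrite !Normc.normcM ha hb mul1r mulr1.
by under eq_bigr do rewrite !Normc.normcM ha hb mul1r mulr1.
Qed.

Lemma nrm_le_trivial X (K : X -> X -> C) :
  (forall x y, nc (K x y) <= 1) -> nrm_le K #|X|%:R.
Proof.
by move=> h; split=> z; rewrite -sum1_card natr_sum; apply: ler_sum.
Qed.

End Kernels.

(** * Polynomials in the spectrum of a tensor product *)

Section Spectral.
Variable R : realType.
Local Notation C := R[i].
Local Notation I := ('i%C : C).
Implicit Types X Y Z : finType.

Definition op X (A B : X -> X -> C) (f : X -> C) x y : C :=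
  \sum_z A x z * f z * B z y.

(* [U = A diag(i ^ w) B] with [B = A ^ -1]. The exponent [w] behaves like a sum of
   [n] independent variables with values in [0, 3] and mean [mu] in total. *)
Record spec (s : R) (n : nat) X (U A B : X -> X -> C) (w : X -> nat) (mu : R)
    : Prop := Spec {
  spec_AB : forall x y, \sum_z A x z * B z y = (x == y)%:R;
  spec_BA : forall z z', \sum_x B z x * A x z' = (z == z')%:R;
  spec_U : forall x y, U x y = op A B (fun z => I ^+ w z) x y;
  spec_nrm : nrm_le (op A B (fun z => (w z)%:R)) (4 * s * n%:R);
  spec_mu : 0 <= mu <= 3 * n%:R;
  spec_exp : forall l : R, `|l| <= 9^-1 ->
    \sum_z expR (l * ((w z)%:R - mu)) <= #|X|%:R * expR (9 * l ^+ 2 * n%:R)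
}.

Lemma eq_spec s n X (U V A B : X -> X -> C) w mu :
  (forall x y, U x y = V x y) -> spec s n U A B w mu -> spec s n V A B w mu.
Proof. by move=> UV [h1 h2 h3 h4 h5 h6]; split=> // x y; rewrite -UV. Qed.

Lemma opD X (A B : X -> X -> C) f g x y :
  op A B (fun z => f z + g z) x y = op A B f x y + op A B g x y.
Proof.
by rewrite /op -big_split; apply: eq_bigr => z _; rewrite mulrDr mulrDl.
Qed.

Lemma opZ X (A B : X -> X -> C) a f x y :
  op A B (fun z => a * f z) x y = a * op A B f x y.
Proof.
by rewrite /op mulr_sumr; apply: eq_bigr => z _; rewrite mulrCA !mulrA.
Qed.

Lemma op_sum X (A B : X -> X -> C) (J : Type) (r : seq J) (f : J -> X -> C) x y :
  op A B (fun z => \sum_(j <- r) f j z) x y = \sum_(j <- r) op A B (f j) x y.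
Proof.
rewrite /op exchange_big /=; apply: eq_bigr => z _.
by rewrite mulr_sumr mulr_suml.
Qed.

Lemma eq_op X (A B : X -> X -> C) f g : f =1 g -> forall x y, op A B f x y = op A B g x y.
Proof. by move=> fg x y; apply: eq_bigr => z _; rewrite fg. Qed.

(** Functional calculus: the product [B A = 1] cancels in the middle, so [f |-> op A B f] is
    multiplicative. This is what lets norms of polynomials in [w] be bounded factor by factor. *)
Lemma opM X (A B : X -> X -> C) f g :
  (forall z z', \sum_x B z x * A x z' = (z == z')%:R) ->
  forall x y, kmul (op A B f) (op A B g) x y = op A B (fun z => f z * g z) x y.
Proof.
move=> BA x y; rewrite /kmul /op.
under eq_bigr do rewrite mulr_suml; rewrite exchange_big /=.
apply: eq_bigr => z _; under eq_bigr do rewrite mulr_sumr.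
rewrite exchange_big /=.
rewrite (eq_bigr (fun z' => (z == z')%:R * (A x z * f z * g z' * B z' y))).
  by rewrite sum_delta -!mulrA.
move=> z' _; rewrite -BA mulr_suml; apply: eq_bigr => t _.
ring.
Qed.

(* [n ^_ k] as a product of (possibly negative) shifted values: truncated
   subtraction agrees because the product has already vanished. *)
Lemma ffact_prod_sub (S : pzRingType) u k :
  (u ^_ k)%:R = \prod_(j < k) (u%:R - j%:R) :> S.
Proof.
elim: k => [|k IHk]; first by rewrite big_ord0.
rewrite big_ord_recr /= -IHk ffactnSr natrM.
have [ku|ku] := leqP k u; first by rewrite natrB.
by rewrite ffact_small // !mul0r.
Qed.

Lemma exprn_binomial_trunc (S : comPzRingType) (x : S) u d : (u <= d)%N ->
  x ^+ u = \sum_(k < d.+1) (x - 1) ^+ k *+ 'C(u, k).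
Proof.
move=> ud; rewrite -{1}[x](subrK 1) addrC exprDn.
rewrite (big_ord_widen d.+1 (fun i => 1 ^+ (u - i) * (x - 1) ^+ i *+ 'C(u, i))) //.
rewrite [RHS](bigID (fun k : 'I_d.+1 => k < u.+1)%N) /= [X in _ = _ + X]big1 ?addr0.
  by apply: eq_bigr => k _; rewrite expr1n mul1r.
by move=> k; rewrite -leqNgt => uk; rewrite bin_small.
Qed.

Lemma sum_exp_coeff_le (y : R) d : 0 <= y ->
  \sum_(k < d) y ^+ k / k`!%:R <= expR y.
Proof.
move=> y0; have := nondecreasing_cvgn_le _ (is_cvg_series_exp_coeff y) d.
rewrite /series /= big_mkord; apply=> m p mp.
rewrite (big_cat_nat _ mp) //= lerDl; apply: sumr_ge0 => i _.
exact: exp_coeff_ge0.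
Qed.

Lemma nc_I : nc I = 1.
Proof. by rewrite /= expr0n expr1n add0r sqrtr1. Qed.

(* In the binomial basis [i ^ w = i ^ w0 * sum_k (i - 1) ^ k * 'C(w - w0, k)],
   and on a window of length [d] the terms with [k > d] vanish. *)
Definition window_poly (w0 d : nat) (w : nat) : C :=
  \sum_(k < d.+1) I ^+ w0 * (I - 1) ^+ k / k`!%:R *
    \prod_(j < k) (w%:R - (w0 + j)%:R).

Lemma window_polyE w0 d w : (w0 <= w <= w0 + d)%N -> window_poly w0 d w = I ^+ w.
Proof.
move=> /andP[w0w wd]; rewrite -(subnKC w0w) exprD.
rewrite (@exprn_binomial_trunc _ I (w - w0) d) ?leq_subLR // mulr_sumr.
apply: eq_bigr => k _.
rewrite -[_ *+ 'C(_, _)]mulr_natr -!mulrA; congr (_ * (_ * _)).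
have k0 : k`!%:R != 0 :> C by rewrite pnatr_eq0 -lt0n fact_gt0.
apply: (mulfI k0); rewrite mulVKf // [RHS]mulrC -natrM bin_ffact ffact_prod_sub.
by apply: eq_bigr => j _; rewrite subnKC // !natrD natrB // opprD addrA.
Qed.

(** Each factor [w - (w0 + j)] has norm at most [4 s n + 4 n <= 8 s n], and each power of [i - 1]
    costs another factor 2, whence the 16. *)
Lemma nrm_le_window s n X U A B w mu w0 d : @spec s n X U A B w mu -> 1 <= s ->
  (forall j, (j < d)%N -> (w0 + j)%:R <= 4 * n%:R :> R) ->
  nrm_le (op A B (fun z => window_poly w0 d (w z)))
    (\sum_(k < d.+1) (16 * s * n%:R) ^+ k / k`!%:R).
Proof.
move=> H s1 hd.
have n0 : 0 <= n%:R :> R by [].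
have fac k : (k <= d)%N ->
    nrm_le (op A B (fun z => \prod_(j < k) ((w z)%:R - (w0 + j)%:R)))
      ((8 * s * n%:R) ^+ k).
  elim: k => [|k IHk] kd.
    rewrite expr0; apply: eq_nrm (nrm_le_id R X) => x y.
    rewrite -(spec_AB H); apply: eq_bigr => z _; by rewrite big_ord0 mulr1.
  rewrite exprSr.
  have step : nrm_le (op A B (fun z => (w z)%:R - (w0 + k)%:R)) (8 * s * n%:R).
    apply: (@nrm_leW _ _ _ _ (4 * s * n%:R + nc (- (w0 + k)%:R : C) * 1)).
      rewrite ncN nc_nat; have := hd _ kd; nra.
    apply: eq_nrm (nrm_leD (spec_nrm H) (nrm_leZ _ (nrm_le_id R X))) => x y.
    rewrite opD; congr (_ + _); rewrite -(spec_AB H) /op mulr_sumr.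
    by apply: eq_bigr => z _; ring.
  have := nrm_le_mul _ _ (IHk (ltnW kd)) step.
  have c0 : 0 <= 8 * s * n%:R by nra.
  move=> /(_ (exprn_ge0 _ c0) c0); apply: eq_nrm => x y.
  rewrite (opM _ _ (spec_BA H)); apply: eq_op => z.
  by rewrite big_ord_recr.
have summand (k : 'I_d.+1) : nrm_le (op A B (fun z => I ^+ w0 * (I - 1) ^+ k / k`!%:R *
    \prod_(j < k) ((w z)%:R - (w0 + j)%:R))) ((16 * s * n%:R) ^+ k / k`!%:R).
  apply: (@nrm_leW _ _ _ _ (nc (I ^+ w0 * (I - 1) ^+ k / k`!%:R) * (8 * s * n%:R) ^+ k)).
    rewrite !Normc.normcM !ncX Normc.normcV nc_nat nc_I expr1n mul1r.
    rewrite -mulrA mulrCA mulrC ler_wpM2r ?invr_ge0 // -exprMn_comm; last exact: mulrC.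
    have h2 : nc (I - 1) <= 2.
      by apply: (le_trans (nc_le_add _ _)); rewrite ncN nc_I nc1; lra.
    have c0 : 0 <= 8 * s * n%:R by nra.
    apply: lerXn2r; rewrite ?nnegrE.
    - by rewrite mulr_ge0 // nc_ge0.
    - by nra.
    - by have := nc_ge0 (I - 1); nra.
  apply: eq_nrm (nrm_leZ _ (fac k _)) => [x y|]; last by rewrite -ltnS.
  by rewrite opZ.
apply: eq_nrm (nrm_le_sum (index_enum _) summand) => x y.
by rewrite op_sum.
Qed.

(** Chernoff's bound for both tails: [l = e / 18] minimises [9 l^2 n - l e n], with value
    [- e^2 n / 36], and [e <= 1] keeps [l] in the range allowed by [spec_exp]. *)
Lemma spec_tail s n X U A B w mu (e : R) : @spec s n X U A B w mu ->
  0 <= e <= 1 ->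
  #|[pred z | e * n%:R < `|(w z)%:R - mu| ]|%:R
    <= 2 * #|X|%:R * expR (- (e ^+ 2 * n%:R / 36)).
Proof.
move=> H /andP[e0 e1].
have l3 : `|e / 18| <= 9^-1 by rewrite ger0_norm; lra.
have l3' : `|- (e / 18)| <= 9^-1 by rewrite normrN.
have h1 := spec_exp H l3; have h2 := spec_exp H l3'.
rewrite -sum1_card natr_sum.
apply: (@le_trans _ _ (\sum_z expR (- (e / 18 * (e * n%:R))) *
   (expR (e / 18 * ((w z)%:R - mu)) + expR (- (e / 18) * ((w z)%:R - mu))))).
  rewrite [leLHS]big_mkcond; apply: ler_sum => z _; rewrite inE /=.
  case: ifP => [hz|_]; last by rewrite mulr_ge0 ?addr_ge0 ?expR_ge0.
  rewrite mulrDr -!expRD; case: (ltrP ((w z)%:R - mu) 0) => h.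
    rewrite ltr0_norm // in hz.
    apply: ler_wpDl; first exact: expR_ge0.
    rewrite -[leLHS]expR0 ler_expR.
    have : 0 <= e / 18 * (- ((w z)%:R - mu) - e * n%:R)
      by apply: mulr_ge0; [exact: divr_ge0|rewrite subr_ge0; exact: ltW].
    lra.
  rewrite ger0_norm // in hz.
  apply: ler_wpDr; first exact: expR_ge0.
  rewrite -[leLHS]expR0 ler_expR.
  have : 0 <= e / 18 * ((w z)%:R - mu - e * n%:R)
    by apply: mulr_ge0; [exact: divr_ge0|rewrite subr_ge0; exact: ltW].
  lra.
rewrite -mulr_sumr big_split /=.
apply: (@le_trans _ _ (expR (- (e / 18 * (e * n%:R))) *
   (#|X|%:R * expR (9 * (e / 18) ^+ 2 * n%:R) + #|X|%:R * expR (9 * (- (e / 18)) ^+ 2 * n%:R)))).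
  by rewrite ler_wpM2l ?expR_ge0 // lerD.
rewrite sqrrN; set q := expR (9 * _ * _); set p := expR _; set t := expR _.
have pq : p * q <= t by rewrite -expRD ler_expR; lra.
have : 0 <= #|X|%:R * (t - p * q) by rewrite mulr_ge0 // subr_ge0.
lra.
Qed.

(** [E] applies the window polynomial to the spectrum. The error is diagonal in the same eigenbasis
    and vanishes wherever [w] is within [e n] of [mu], so its rank is controlled by the tail. *)
Lemma spec_approx s n X U A B w mu (e : R) : @spec s n X U A B w mu -> 1 <= s ->
  0 < e <= 2^-1 ->
  exists E : X -> X -> C,
    rk_le (fun x y => U x y - E x y)
      (2 * #|X|%:R * expR (- (e ^+ 2 * n%:R / 36))) /\
    nrm_le E (expR ((2 * e * n%:R + 1) * (ln (16 * s / e) + 1))).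
Proof.
move=> H s1 /andP[e0 e1].
have /andP[mu0 mu3] := spec_mu H.
have n0 : 0 <= n%:R :> R by [].
(* The window starts at the integer part of [mu - e n], cut off at 0. The extra 1 in [d] makes up
   for both roundings, so that it still reaches [mu + e n]. *)
pose w0 := Num.trunc (Num.max 0 (mu - e * n%:R)).
pose d := (Num.trunc (2 * e * n%:R)).+1.
have w0_le : (w0%:R <= Num.max 0 (mu - e * n%:R)).
  by rewrite truncn_le le_max lexx.
have w0_gt : Num.max 0 (mu - e * n%:R) < w0%:R + 1.
  have m0 : 0 <= Num.max 0 (mu - e * n%:R) by rewrite le_max lexx.
  by rewrite natr1; have /andP[] := truncn_itv m0.
have en0 : 0 <= 2 * e * n%:R by nra.
have d_le : d%:R <= 2 * e * n%:R + 1.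
  by rewrite -[d%:R]natr1 lerD2r truncn_le.
have d_gt : 2 * e * n%:R < d%:R by have /andP[] := truncn_itv en0.
exists (op A B (fun z => window_poly w0 d (w z))); split.
  have lt1 : e <= 1 by lra.
  apply: rk_leW (spec_tail H (e := e) _) _; first by rewrite (ltW e0).
  apply: eq_rk (rk_le_diag A B
    (d := fun z => I ^+ w z - window_poly w0 d (w z)) _) => [x y|z].
    rewrite (spec_U H) /op -sumrB; apply: eq_bigr => z _; ring.
  rewrite inE /= -leNgt => hz; apply/eqP; rewrite subr_eq0; apply/eqP.
  rewrite window_polyE //; move: hz; rewrite ler_norml => /andP[hz1 hz2].
  apply/andP; split.
    rewrite -(ler_nat R); apply: (le_trans w0_le).
    by rewrite ge_max ler0n; lra.
  rewrite -ltnS -(ltr_nat R) -natr1 natrD.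
  have : mu - e * n%:R <= Num.max 0 (mu - e * n%:R) by rewrite le_max lexx orbT.
  lra.
apply: nrm_leW (nrm_le_window H s1 _) => [|j jd]; last first.
  have : j%:R <= 2 * e * n%:R :> R.
    by rewrite (le_trans _ (_ : (d.-1)%:R <= _)) ?truncn_le // ler_nat -ltnS.
  have : Num.max 0 (mu - e * n%:R) <= 3 * n%:R.
    rewrite ge_max; apply/andP; split; nra.
  rewrite natrD; nra.
(* With this [c], [(16 s n)^k / k! = c^k (e n)^k / k!]. Bounding [c^k] by [c^d] leaves a partial sum
   of the series of [expR (e n)]. *)
set c := 16 * s / e.
have c1 : 1 <= c by rewrite /c ler_pdivlMr //; lra.
apply: (@le_trans _ _ (c ^+ d * expR (e * n%:R))).
  apply: (@le_trans _ _ (c ^+ d * \sum_(k < d.+1) (e * n%:R) ^+ k / k`!%:R)).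
    rewrite mulr_sumr; apply: ler_sum => k _.
    have -> : 16 * s * n%:R = c * (e * n%:R) by rewrite /c; field; rewrite gt_eqF.
    rewrite exprMn -mulrA ler_wpM2r //.
      by rewrite mulr_ge0 ?invr_ge0 // exprn_ge0 //; nra.
    by rewrite ler_weXn2l // -ltnS.
  by rewrite ler_wpM2l ?exprn_ge0 ?sum_exp_coeff_le //; [lra|nra].
have -> : c ^+ d = expR (ln c * d%:R) by rewrite expRM_natr lnK // posrE; lra.
have := ln_ge0 c1; rewrite -expRD ler_expR; nra.
Qed.

End Spectral.

(** * Spectral data of tensor products and of matrices of order four *)

Section SpecConstructions.
Variable R : realType.
Local Notation C := R[i].
Local Notation I := ('i%C : C).
Implicit Types X Y Z : finType.

Lemma nat_delta_pair X Y (x x' : X * Y) :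
  (x == x')%:R = (x.1 == x'.1)%:R * (x.2 == x'.2)%:R :> C.
Proof. by rewrite -natrM mulnb; congr (_%:R); case: x x' => a b [c d]. Qed.

Lemma op_tens X Y (A B : X -> X -> C) (A' B' : Y -> Y -> C) f g x y :
  op (tens A A') (tens B B') (fun z => f z.1 * g z.2) x y =
  op A B f x.1 y.1 * op A' B' g x.2 y.2.
Proof.
rewrite /op -(sum_pair_mul (fun z => A x.1 z * f z * B z y.1)).
by apply: eq_bigr => z _; rewrite /tens; ring.
Qed.

Lemma op1 X (A B : X -> X -> C) x y :
  (forall x y, \sum_z A x z * B z y = (x == y)%:R) ->
  op A B (fun=> 1) x y = (x == y)%:R.
Proof. by move=> h; rewrite -h; apply: eq_bigr => z _; rewrite mulr1. Qed.

(** Exponents add because [i^(w + w') = i^w i^w']. The operator of the sum is that of [w] tensored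
    with 1 plus 1 tensored with that of [w'], so norms add, while exponential moments multiply as
    for independent variables. *)
Lemma spec_tens s n n' X Y U A B w mu U' A' B' w' mu' : 0 <= s ->
  @spec R s n X U A B w mu -> @spec R s n' Y U' A' B' w' mu' ->
  spec s (n + n') (tens U U') (tens A A') (tens B B')
    (fun z => w z.1 + w' z.2)%N (mu + mu').
Proof.
move=> s0 H H'; split.
- move=> x y; rewrite nat_delta_pair -(spec_AB H) -(spec_AB H').
  rewrite -(sum_pair_mul (fun z => A x.1 z * B z y.1)).
  by apply: eq_bigr => z _; rewrite /tens mulrACA.
- move=> x y; rewrite nat_delta_pair -(spec_BA H) -(spec_BA H').
  rewrite -(sum_pair_mul (fun z => B x.1 z * A z y.1)).
  by apply: eq_bigr => z _; rewrite /tens mulrACA.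
- move=> x y; rewrite /tens (spec_U H) (spec_U H') -op_tens.
  by apply: eq_op => z; rewrite exprD.
- rewrite natrD mulrDr.
  have h1 := nrm_le_tens (spec_nrm H) (nrm_le_id R Y).
  have h2 := nrm_le_tens (nrm_le_id R X) (spec_nrm H').
  rewrite mulr1 in h1; rewrite mul1r in h2.
  apply: eq_nrm (nrm_leD h1 h2) => x y.
  rewrite /tens -(op1 _ _ (spec_AB H)) -(op1 _ _ (spec_AB H')) -!op_tens -opD.
  by apply: eq_op => z; rewrite natrD mulr1 mul1r.
- have /andP[a b] := spec_mu H; have /andP[a' b'] := spec_mu H'.
  by rewrite natrD; lra.
- move=> l hl; have h := spec_exp H hl; have h' := spec_exp H' hl.
  rewrite card_prod natrM natrD mulrDr expRD mulrACA.
  apply: le_trans (ler_pM _ _ h h'); last 2 first.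
  - by apply: sumr_ge0 => *; apply: expR_ge0.
  - by apply: sumr_ge0 => *; apply: expR_ge0.
  rewrite -(sum_pair_mul (fun z => expR (l * ((w z)%:R - mu)))).
  apply: ler_sum => z _; rewrite -expRD ler_expR natrD; lra.
Qed.

Lemma spec_unit s : @spec R s 0 'I_1 (fun _ _ => 1) (fun _ _ => 1) (fun _ _ => 1)
   (fun=> 0%N) 0.
Proof.
have o1 (x y : 'I_1) : (x == y) = true by rewrite !ord1.
split.
- by move=> x y; rewrite big_ord1 o1 mulr1.
- by move=> x y; rewrite big_ord1 o1 mulr1.
- by move=> x y; rewrite /op big_ord1 expr0 !mulr1.
- by split=> z; rewrite big_ord1 /op big_ord1 mulr0 mul0r Normc.normc0 mulr0.
- by rewrite mulr0 lexx.
- by move=> l _; rewrite big_ord1 card_ord mulr0 subrr mulr0 mul1r.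
Qed.

(** The bound [expR u <= 1 / (1 - u)] is too weak at [u = y], but its square at [u = y / 2]
    suffices. *)
Lemma expR_le_quadratic (y : R) : `|y| <= 3^-1 -> expR y <= 1 + y + y ^+ 2.
Proof.
rewrite ler_norml => /andP[y1 y2].
have h (u : R) : u < 1 -> expR u <= (1 - u)^-1.
  move=> u1; rewrite -[u]opprK expRN lef_pV2 ?posrE ?expR_gt0 //; last by lra.
  by rewrite opprK; apply: expR_ge1Dx.
have := h (y / 2) ltac:(lra) => hy.
have -> : expR y = expR (y / 2) ^+ 2.
  by rewrite expr2 -expRD; congr expR; lra.
apply: (@le_trans _ _ ((1 - y / 2)^-1 ^+ 2)).
  by apply: lerXn2r; rewrite ?nnegrE ?expR_ge0 // invr_ge0; lra.
rewrite exprVn -[leRHS]mulr1 -[leLHS]mul1r ler_pdivrMr; last by rewrite exprn_gt0; lra.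
have -> : (1 + y + y ^+ 2) * 1 * (1 - y / 2) ^+ 2
   = 1 + y ^+ 2 / 4 * (1 - 3 * y + y ^+ 2) by field.
rewrite lerDl mulr_ge0 ?divr_ge0 ?sqr_ge0 //.
have := sqr_ge0 y; lra.
Qed.

(** After the quadratic bound on [expR] the linear term sums to 0, [mu] being the mean, and the
    quadratic one is at most [9 l^2] since [w] and [mu] lie in [0, 3]. *)
Lemma exp_moment_le X (w : X -> nat) (l : R) : (0 < #|X|)%N ->
  (forall z, (w z <= 3)%N) -> `|l| <= 9^-1 ->
  \sum_z expR (l * ((w z)%:R - (\sum_z (w z)%:R) / #|X|%:R))
    <= #|X|%:R * expR (9 * l ^+ 2).
Proof.
move=> X0 w3 hl; set mu := _ / _.
have X0' : 0 < #|X|%:R :> R by rewrite ltr0n.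
have w3' z : 0 <= ((w z)%:R : R) <= 3 by rewrite ler0n (ler_nat R _ 3) w3.
have mu3 : 0 <= mu <= 3.
  rewrite /mu divr_ge0 ?sumr_ge0 //= ler_pdivrMr //.
  apply: (@le_trans _ _ (\sum_(z : X) 3)); last by rewrite sumr_const mulr_natr.
  by apply: ler_sum => z _; have /andP[] := w3' z.
have sq z : ((w z)%:R - mu) ^+ 2 <= 9 by have := w3' z; nra.
have ab z : `|(w z)%:R - mu| <= 3 by rewrite ler_norml; have := w3' z; lra.
apply: (@le_trans _ _ (\sum_z (1 + l * ((w z)%:R - mu) + 9 * l ^+ 2))).
  apply: ler_sum => z _.
  have : `|l * ((w z)%:R - mu)| <= 3^-1.
    rewrite normrM (le_trans (ler_pM _ _ hl (ab z))) //; lra.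
  move=> /expR_le_quadratic /le_trans; apply; rewrite lerD2l exprMn.
  by rewrite mulrC ler_wpM2r ?sqr_ge0.
rewrite !big_split /= -mulr_sumr sumrB !sumr_const -[mu *+ _]mulr_natr /mu.
rewrite divfK ?gt_eqF // subrr mulr0 addr0 -mulrnDl -[leLHS]mulr_natl ler_wpM2l //.
exact: expR_ge1Dx.
Qed.

(** The polynomial [X^4 - 1] has four distinct roots, so [M] is diagonalizable with eigenvalues
    [i^w]. The bound on [M^2] gives [M^3] the same norm bound as [M]. *)
Lemma spec_order4 s q (M : 'M[C]_q.+1) : 1 <= s -> M ^+ 4 = 1 ->
  nrm_le (fun i j => M i j) s -> nrm_le (fun i j => (M ^+ 2) i j) 1 ->
  exists A B w mu, spec s 1 (fun i j => M i j) A B w mu.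
Proof.
move=> s1 M4 nM nM2.
have I2 : I ^+ 2 = -1 by exact: sqr_i.
have I3 : I ^+ 3 = - I by rewrite exprSr I2 mulN1r.
have [P Pu /diagonalizable_forPex[d /(simmxP Pu) PM]] : diagonalizable M.
  apply/diagonalizableP; exists [:: 1; -1; I; - I].
    have n2 : (2 : C) != 0 by rewrite pnatr_eq0.
    have nI : I != 0 by rewrite eq_complex /= oner_eq0 andbF.
    have ne (x y : C) : x - y != 0 -> x != y by rewrite subr_eq0.
    have ne1 : (1 : C) != -1 by apply: ne; rewrite opprK -mulr2n.
    have neI (x : C) : x ^+ 2 = 1 -> (x != I) && (x != - I).
      move=> x2; have h (y : C) : y ^+ 2 = -1 -> x != y.
        by move=> y2; apply: contraNneq ne1 => xy; rewrite -{1}x2 xy y2.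
      by rewrite !h // sqrrN.
    have /andP[a1 a2] := neI 1 (expr1n _ _).
    have /andP[b1 b2] := neI (-1) (ltac:(by rewrite sqrrN expr1n)).
    have c1 : I != - I by apply: ne; rewrite opprK -mulr2n -mulr_natl mulf_neq0.
    by rewrite /= !inE !negb_or ne1 a1 a2 b1 b2 c1.
  apply: mxminpoly_min.
  have -> : \prod_(x <- [:: 1; -1; I; - I]) ('X - x%:P) = 'X^4 - 1 :> {poly C}.
    rewrite !big_cons big_nil mulr1 !polyCN !opprK.
    have IP : (I%:P) ^+ 2 = -1 :> {poly C} by rewrite -rmorphXn /= I2 polyCN.
    transitivity (('X^2 - 1) * ('X^2 - I%:P ^+ 2) : {poly C}); first by rewrite polyC1; ring.
    by rewrite IP opprK; ring.
  by rewrite rmorphB rmorphXn /= rmorph1 horner_mx_X M4 subrr.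
have Pk k : P *m M ^+ k = diag_mx (\row_j d 0 j ^+ k) *m P.
  elim: k => [|k IHk].
    rewrite expr0 [_ *m 1]mulr1; have -> : (\row_j d 0 j ^+ 0) = const_mx 1.
      by apply/rowP => j; rewrite !mxE expr0.
    by rewrite diag_const_mx mul1mx.
  rewrite exprS mulmxA PM -mulmxA IHk mulmxA; congr (_ *m P).
  rewrite mulmx_diag; congr diag_mx; apply/rowP => j; by rewrite !mxE exprS.
have d4 j : d 0 j ^+ 4 = 1.
  have := Pk 4; rewrite M4 [_ *m 1]mulr1 => /(congr1 (mulmx^~ (invmx P))).
  rewrite -mulmxA mulmxV // mulmx1 => /matrixP/(_ j j).
  by rewrite !mxE eqxx.
have dI j : exists k, (k <= 3)%N && (d 0 j == I ^+ k).
  have : (d 0 j - 1) * (d 0 j + 1) * ((d 0 j - I) * (d 0 j + I)) = 0.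
    transitivity ((d 0 j ^+ 2 - 1) * (d 0 j ^+ 2 - I ^+ 2)); first by ring.
    rewrite I2 opprK; transitivity (d 0 j ^+ 4 - 1); first by ring.
    by rewrite d4 subrr.
  move/eqP; rewrite !mulf_eq0 -orbA => /or4P[] h.
  - by exists 0%N; rewrite expr0 -subr_eq0.
  - by exists 2%N; rewrite I2 -subr_eq0 opprK.
  - by exists 1%N; rewrite expr1 -subr_eq0.
  - by exists 3%N; rewrite I3 -subr_eq0 opprK.
pose w j := xchoose (dI j).
have w3 j : (w j <= 3)%N by have /andP[] := xchooseP (dI j).
have dw j : d 0 j = I ^+ w j by have /andP[_ /eqP] := xchooseP (dI j).
have opk k i j : op (fun i j => invmx P i j) (fun i j => P i j)
    (fun z => (I ^+ w z) ^+ k) i j = (M ^+ k) i j.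
  have -> : M ^+ k = invmx P *m (diag_mx (\row_j d 0 j ^+ k) *m P).
    by rewrite -Pk mulKmx.
  rewrite mul_diag_mx mxE; apply: eq_bigr => z _; rewrite !mxE dw; ring.
have nI2 : nc (2^-1 : C) = 2^-1 by rewrite Normc.normcV nc_nat.
have nh (a b : C) : nc a = 1 -> nc b = 1 -> nc (2^-1 * (a + b)) <= 1.
  move=> na nb; rewrite Normc.normcM nI2; have := nc_le_add a b; lra.
have nM3 : nrm_le (fun i j => (M ^+ 3) i j) s.
  have := nrm_le_mul _ _ nM2 nM; rewrite mul1r; move=> /(_ ltac:(lra) ltac:(lra)).
  by apply: eq_nrm => i j; rewrite (exprSr M 2) [RHS]mxE.
exists (fun i j => invmx P i j), (fun i j => P i j), w,
  ((\sum_z (w z)%:R) / #|'I_q.+1|%:R); split.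
- by move=> i j; have := mulVmx Pu => /matrixP/(_ i j); rewrite !mxE.
- by move=> i j; have := mulmxV Pu => /matrixP/(_ i j); rewrite !mxE.
- by move=> i j; rewrite -[M in LHS]expr1 -opk.
- have nc3 : nc (3 / 2 : C) = 3 / 2 by rewrite Normc.normcM nI2 nc_nat.
  have n1 : nc (-1 : C) = 1 by rewrite ncN nc1.
  have nmI : nc (- I) = 1 by rewrite ncN nc_I.
  (* Interpolation at the fourth roots of unity: for [w] in 0, 1, 2, 3, [w = 3/2 + (-1 + i)/2 i^w -
     1/2 i^(2w) + (-1 - i)/2 i^(3w)]. This writes the operator of [w] as a cubic in [M], of norm at
     most [2 + 2 s <= 4 s]. *)
  apply: (@nrm_leW _ _ _ _ (nc (3 / 2 : C) * 1 + nc (2^-1 * (-1 + I)) * s +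
     nc (- 2^-1 : C) * 1 + nc (2^-1 * (-1 + - I)) * s)).
    rewrite nc3 ncN nI2.
    have := nh _ _ n1 (nc_I R); have := nh _ _ n1 nmI; nra.
  have Z0 := nrm_leZ (3 / 2) (nrm_le_id R 'I_q.+1).
  have Z1 := nrm_leZ (2^-1 * (-1 + I)) nM.
  have Z2 := nrm_leZ (- 2^-1) nM2.
  have Z3 := nrm_leZ (2^-1 * (-1 + - I)) nM3.
  apply: eq_nrm (nrm_leD (nrm_leD (nrm_leD Z0 Z1) Z2) Z3) => i j.
  have -> : (i == j)%:R = (M ^+ 0) i j by rewrite expr0 mxE.
  rewrite -{2}[M]expr1 -!opk -!opZ -!opD; apply: eq_op => z.
  have n2 : (2 : C) != 0 by rewrite pnatr_eq0.
  have II : I * I = -1 by rewrite -expr2.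
  have e1 : (-1 + I) * I = - I - 1 by rewrite mulrDl II; ring.
  have e2 : (-1 + I) * - I = I + 1 by rewrite mulrN e1; ring.
  have e3 : (-1 + - I) * - I = I - 1 by rewrite mulrN mulrDl [- I * I]mulNr II; ring.
  have e4 : (-1 + - I) * I = - I + 1 by rewrite mulrDl [- I * I]mulNr II; ring.
  case: (w z) (w3 z) => [|[|[|[|//]]]] _;
    rewrite ?expr0 ?expr1n ?expr1 -?exprM ?expr0 ?expr1 ?I2 ?I3.
  + by field.
  + by rewrite -!mulrA e1 e3; field.
  + have -> : I ^+ (2 * 2) = 1 by rewrite exprM I2 sqrrN expr1n.
    have -> : I ^+ (2 * 3) = -1 by rewrite exprM I2 -signr_odd expr1.
    by field.
  + have -> : I ^+ (3 * 2) = -1 by rewrite exprM I3 sqrrN I2.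
    have -> : I ^+ (3 * 3) = I by rewrite exprM I3 exprNn I3 -signr_odd expr1 mulN1r opprK.
    by rewrite -!mulrA e2 e4; field.
- rewrite mulr1 divr_ge0 ?sumr_ge0 //= ler_pdivrMr ?ltr0n ?card_ord //.
  apply: (@le_trans _ _ (\sum_(z : 'I_q.+1) 3)); last by rewrite sumr_const mulr_natr card_ord.
  by apply: ler_sum => z _; rewrite (ler_nat R _ 3).
- by move=> l hl; rewrite mulr1 exp_moment_le // card_ord.
Qed.

End SpecConstructions.

HB.instance Definition _ (H H' : finZmodType) := GRing.Zmodule.on (H * H')%type.

(** * Fourier matrices of products of cyclic groups *)

Section FourierSystems.
Variable R : realType.
Local Notation C := R[i].

Definition e2pi (t : R) : C := (cos (2 * pi * t) +i* sin (2 * pi * t))%C.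

Lemma e2piD s t : e2pi (s + t) = e2pi s * e2pi t.
Proof.
rewrite /e2pi mulrDr cosD sinD; rewrite /GRing.mul /=; congr (_ +i* _)%C.
by rewrite addrC [cos _ * sin _]mulrC addrC [X in _ + X]mulrC addrC.
Qed.

Lemma e2pi0 : e2pi 0 = 1.
Proof. by rewrite /e2pi mulr0 cos0 sin0. Qed.

Lemma nc_e2pi t : nc (e2pi t) = 1.
Proof. by rewrite /= cos2Dsin2 sqrtr1. Qed.

Lemma e2piN t : e2pi (- t) = conjc (e2pi t).
Proof. by rewrite /e2pi mulrN cosN sinN. Qed.

Lemma e2piMn (t : R) n : e2pi (n%:R * t) = e2pi t ^+ n.
Proof.
elim: n => [|n IHn]; first by rewrite mul0r e2pi0.
by rewrite -natr1 mulrDl mul1r e2piD IHn exprSr.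
Qed.

Lemma e2pi1 : e2pi 1 = 1.
Proof. by rewrite /e2pi mulr1 mulr_natl cos2pi sin2pi. Qed.

Lemma e2pi_nat n : e2pi n%:R = 1.
Proof. by rewrite -[n%:R]mulr1 e2piMn e2pi1 expr1n. Qed.

(** The real part is [1 - 2 sin^2(pi t)], and [sin] is positive on the open interval from 0 to
    pi. *)
Lemma e2pi_neq1 t : 0 < t < 1 -> e2pi t != 1.
Proof.
move=> /andP[t0 t1]; apply/negP => /eqP [] + _.
have -> : 2 * pi * t = pi * t + pi * t by ring.
have pi0 := pi_gt0 R.
have s0 : 0 < sin (pi * t) by apply: sin_gt0_pi; apply/andP; split; nra.
rewrite cosD -!expr2 => h.
have := cos2Dsin2 (pi * t); nra.
Qed.

Lemma e2pi_prim n : n.+1.-primitive_root (e2pi n.+1%:R^-1).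
Proof.
have n0 : n.+1%:R != 0 :> R by rewrite pnatr_eq0.
have r1 : e2pi n.+1%:R^-1 ^+ n.+1 = 1 by rewrite -e2piMn divff // e2pi1.
apply/andP; split=> //; apply/forallP => i; apply/eqP.
have [->|ni] := eqVneq i.+1 n.+1; first by apply/unity_rootP.
apply/negbTE/unity_rootP; rewrite -e2piMn; apply/eqP/e2pi_neq1.
rewrite mulr_gt0 ?ltr0n ?invr_gt0 ?ltr0n //= ltr_pdivrMr ?ltr0n // mul1r ltr_nat.
by rewrite ltn_neqAle ni ltn_ord.
Qed.

(** An abstract Fourier matrix: the columns are characters of [H], and [n] counts the cyclic factors
    entering the spectral data of the normalised matrix. *)
Record fsys (s : R) (n : nat) (H : finZmodType) (F : H -> H -> C) : Prop := Fsys {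
  fsysD : forall x y k, F (x + y) k = F x k * F y k;
  fsys_nc : forall x k, nc (F x k) = 1;
  fsys_orth : forall x, \sum_k F x k = #|H|%:R * (x == 0)%:R;
  fsys_spec : exists A B w mu,
    spec s n (fun x k => (Num.sqrt #|H|%:R)^-1%:C%C * F x k) A B w mu
}.

Lemma fsys_unit (s : R) : fsys s 0 (fun _ _ : 'I_1 => 1).
Proof.
split=> [x y k|x k|x|]; rewrite ?mulr1 ?nc1 //.
  by rewrite big_ord1 card_ord !ord1 eqxx mulr1.
do 4!eexists; apply: eq_spec (spec_unit s) => x y.
by rewrite card_ord sqrtr1 invr1 [RHS](_ : _ = 1 * 1) ?mulr1.
Qed.

Lemma fsys_tens (s : R) n n' (H H' : finZmodType) (F : H -> H -> C) (F' : H' -> H' -> C) :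
  0 <= s -> fsys s n F -> fsys s n' F' ->
  fsys s (n + n') (H := (H * H')%type) (tens F F').
Proof.
move=> s0 f f'; split=> [x y k|x k|x|].
- by rewrite /tens /= (fsysD f) (fsysD f') mulrACA.
- by rewrite /tens Normc.normcM (fsys_nc f) (fsys_nc f') mulr1.
- rewrite /tens (sum_pair_mul (fun k => F x.1 k) (fun k => F' x.2 k)).
  by rewrite (fsys_orth f) (fsys_orth f') card_prod natrM nat_delta_pair mulrACA.
have [A [B [w [mu h]]]] := fsys_spec f.
have [A' [B' [w' [mu' h']]]] := fsys_spec f'.
do 4!eexists; apply: eq_spec (spec_tens s0 h h') => x k.
rewrite /tens card_prod natrM.
by rewrite sqrtrM // invfM rmorphM mulrACA.
Qed.

Definition zkern p (x k : 'I_p.+1) : C := e2pi p.+1%:R^-1 ^+ (x * k).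

Lemma zkernE p x k : @zkern p x k = e2pi ((x * k)%:R / p.+1%:R).
Proof. by rewrite e2piMn. Qed.

Lemma zkernC p x k : @zkern p x k = zkern k x.
Proof. by rewrite /zkern mulnC. Qed.

(** The normalised Fourier matrix squares to the permutation matrix of [x |-> - x], so it has order
    dividing 4 and its square has norm 1. Its own row sums equal the square root of the order. *)
Lemma fsys_cyclic (s : R) p : 1 <= s -> Num.sqrt p.+1%:R <= s -> fsys s 1 (@zkern p).
Proof.
move=> s1 ps; have pr := e2pi_prim p; set om := e2pi _ in pr.
have omp := prim_expr_order pr.
have zD (x y k : 'I_p.+1) : zkern (x + y) k = zkern x k * zkern y k.
  by rewrite /zkern -/om -exprD -mulnDl !(mulnC _ (k : nat)) !(exprM _ k) expr_mod //
    -exprM mulnC exprM omp expr1n.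
have orth (x : 'I_p.+1) : \sum_k zkern x k = p.+1%:R * (x == 0)%:R.
  under eq_bigr do rewrite /zkern -/om exprM.
  have [->|x0] := eqVneq x 0.
    under eq_bigr do rewrite expr0 expr1n.
    by rewrite sumr_const card_ord mulr1.
  rewrite mulr0; apply/eqP.
  have : (om ^+ x - 1) * \sum_(k < p.+1) (om ^+ x) ^+ k == 0.
    by rewrite -subrX1 -exprM mulnC exprM omp expr1n subrr.
  rewrite mulf_eq0 subr_eq0 => /orP[|//].
  rewrite -(prim_order_dvd pr) => d; case/negP: x0; apply/eqP/val_inj => /=.
  by apply/eqP; move: d; rewrite /dvdn modn_small.
have sq0 : 0 < Num.sqrt (p.+1%:R : R) by rewrite sqrtr_gt0 ltr0n.
have sqq : Num.sqrt (p.+1%:R : R) ^+ 2 = p.+1%:R by rewrite sqr_sqrtr.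
split=> [//|x k||]; first by rewrite zkernE nc_e2pi.
  by move=> x; rewrite orth card_ord.
rewrite card_ord; set c : C := _%:C%C.
have ncc : nc c = (Num.sqrt p.+1%:R)^-1 by rewrite nc_real // invr_ge0 ltW.
have cc : c * c * p.+1%:R = 1.
  rewrite -(rmorph_nat (real_complex R)) -!rmorphM /=.
  have -> : (Num.sqrt p.+1%:R)^-1 / Num.sqrt p.+1%:R * p.+1%:R = 1 :> R.
    by rewrite -{3}sqq; field; rewrite gt_eqF.
  by [].
pose M : 'M[C]_p.+1 := \matrix_(x, k) (c * zkern x k).
have M2 : M ^+ 2 = \matrix_(x, y) (x + y == 0)%:R.
  apply/matrixP => x y; rewrite expr2 !mxE.
  transitivity (c * c * \sum_k zkern (x + y) k).
    rewrite mulr_sumr; apply: eq_bigr => k _; rewrite !mxE zD [zkern y k]zkernC; ring.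
  by rewrite orth mulrA cc mul1r.
suff [A [B [w [mu h]]]] : exists A B w mu, spec s 1 (fun i j => M i j) A B w mu.
  by exists A, B, w, mu; apply: eq_spec h => x y; rewrite mxE.
apply: spec_order4 => //.
- rewrite (exprM _ 2 2) M2; apply/matrixP => x y; rewrite expr2 !mxE.
  rewrite (bigD1 (- x)) //= !mxE subrr eqxx mul1r [- x + y]addrC subr_eq0 eq_sym.
  rewrite big1 ?addr0 // => z /negbTE zx; rewrite !mxE addrC addr_eq0 zx mul0r //.
- have row : \sum_(k < p.+1) (Num.sqrt (p.+1%:R : R))^-1 = Num.sqrt p.+1%:R.
    rewrite sumr_const card_ord -[_ *+ p.+1]mulr_natr -{2}sqq; field; by rewrite gt_eqF.
  split=> x; under eq_bigr do rewrite mxE Normc.normcM ncc zkernE nc_e2pi mulr1.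
    by rewrite row.
  by rewrite row.
- rewrite M2; split=> x; under eq_bigr do rewrite mxE nc_nat.
    rewrite (bigD1 (- x)) //= subrr eqxx big1 ?addr0 // => z /negbTE zx.
    by rewrite addrC addr_eq0 zx.
  rewrite (bigD1 (- x)) //= addNr eqxx big1 ?addr0 // => z /negbTE zx.
  by rewrite addr_eq0 zx.
Qed.

Lemma fsys_approx s n (H : finZmodType) (F : H -> H -> C) (e : R) :
  fsys s n F -> 1 <= s -> 0 < e <= 2^-1 ->
  exists E : H -> H -> C,
    rk_le (fun x y => F x y - E x y)
      (2 * #|H|%:R * expR (- (e ^+ 2 * n%:R / 36))) /\
    nrm_le E (Num.sqrt #|H|%:R * expR ((2 * e * n%:R + 1) * (ln (16 * s / e) + 1))).
Proof.
move=> f s1 he; have [A [B [w [mu h]]]] := fsys_spec f.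
have [E [h1 h2]] := spec_approx h s1 he.
have sq0 : 0 < Num.sqrt (#|H|%:R : R) by rewrite sqrtr_gt0 ltr0n; apply/card_gt0P; exists 0.
exists (fun x y => (Num.sqrt #|H|%:R)%:C%C * E x y); split.
  apply: eq_rk (rk_le_scale (fun=> (Num.sqrt #|H|%:R)%:C%C) (fun=> 1) h1) => x y.
  rewrite mulr1 mulrBr mulrA -rmorphM divff ?gt_eqF // mul1r //.
have := nrm_leZ (Num.sqrt #|H|%:R)%:C%C h2.
by rewrite nc_real // ltW.
Qed.

End FourierSystems.

(** * Toeplitz matrices *)

Section Toeplitz.
Variable R : realType.
Local Notation C := R[i].

Lemma conjcM (x y : C) : conjc (x * y) = conjc x * conjc y.
Proof. exact: rmorphM. Qed.

Lemma rk_le_adjoint (X Y : finType) (K : X -> Y -> C) r :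
  rk_le K r -> rk_le (fun y x => conjc (K x y)) r.
Proof.
move=> [Z [u [v [hZ h]]]].
exists Z, (fun y z => conjc (v z y)), (fun z x => conjc (u x z)); split=> // y x.
by rewrite h rmorph_sum; apply: eq_bigr => z _; rewrite /= conjcM mulrC.
Qed.

Lemma nrm_le_adjoint (X Y : finType) (K : X -> Y -> C) c :
  nrm_le K c -> nrm_le (fun y x => conjc (K x y)) c.
Proof.
by move=> [h1 h2]; split=> z; under eq_bigr do rewrite ncJ.
Qed.

Lemma nrm_le_mull (X Y : finType) (a : X -> C) (K : X -> Y -> C) c d :
  0 <= d -> (forall x, nc (a x) <= d) ->
  nrm_le K c -> nrm_le (fun x y => a x * K x y) (d * c).
Proof.
move=> d0 ad [h1 h2]; split=> z.
  apply: le_trans (ler_wpM2l d0 (h1 z)); rewrite mulr_sumr; apply: ler_sum => y _.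
  by rewrite Normc.normcM ler_wpM2r ?nc_ge0.
apply: le_trans (ler_wpM2l d0 (h2 z)); rewrite mulr_sumr; apply: ler_sum => y _.
by rewrite Normc.normcM ler_wpM2r ?nc_ge0.
Qed.

Section FourierTransform.
Variables (s : R) (n : nat) (H : finZmodType) (F : H -> H -> C).
Hypothesis f : fsys s n F.
Let M : C := #|H|%:R.

Let M0 : M != 0.
Proof. by rewrite pnatr_eq0 -lt0n; apply/card_gt0P; exists 0. Qed.

Lemma fsysB x y k : F (x - y) k = F x k * conjc (F y k).
Proof.
have -> : F x k = F (x - y) k * F y k by rewrite -(fsysD f) subrK.
by rewrite -mulrA mul_conjc (fsys_nc f) expr1n mulr1.
Qed.

Definition fhat (g : H -> C) k : C := \sum_h g h * conjc (F h k).

Lemma fhat_inv g x : g x = M^-1 * \sum_k fhat g k * F x k.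
Proof.
apply: (mulfI M0); rewrite mulrA divff // mul1r /fhat.
under eq_bigr do rewrite mulr_suml.
rewrite exchange_big /=.
rewrite (eq_bigr (fun h => (x == h)%:R * (M * g h))) ?sum_delta // => h _.
under eq_bigr do rewrite -mulrA [conjc _ * _]mulrC -fsysB.
by rewrite -mulr_sumr (fsys_orth f) subr_eq0 mulrC mulrAC mulrC mulrA.
Qed.

Lemma parseval g : \sum_k nc (fhat g k) ^+ 2 = #|H|%:R * \sum_h nc (g h) ^+ 2.
Proof.
apply: complexI; rewrite rmorphM rmorph_nat !rmorph_sum /=.
under eq_bigr do rewrite -mul_conjc.
under [in RHS]eq_bigr do rewrite -mul_conjc.
transitivity (\sum_k \sum_h conjc (g h) * (fhat g k * F h k)).
  apply: eq_bigr => k _; rewrite [X in _ * conjc X]/fhat rmorph_sum mulr_sumr.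
  by apply: eq_bigr => h _; rewrite /= conjcM conjcK; ring.
rewrite exchange_big mulr_sumr; apply: eq_bigr => h _ /=.
have -> : \sum_k conjc (g h) * (fhat g k * F h k) = conjc (g h) * (M * g h).
  have gi : M * g h = \sum_k fhat g k * F h k.
    by rewrite (fhat_inv g h) mulrA divff // mul1r.
  by rewrite gi mulr_sumr.
rewrite /M; ring.
Qed.

(** Fourier inversion diagonalises a circulant, with the Fourier coefficients of [g] as
    eigenvalues. *)
Lemma toeplitz_expand g x y :
  g (x - y) = \sum_k F x k * (M^-1 * fhat g k) * conjc (F y k).
Proof.
rewrite (fhat_inv g) mulr_sumr; apply: eq_bigr => k _; rewrite fsysB; ring.
Qed.

(* A circulant is [F D F^*] up to scaling. Replacing [F] by its sparse part
   costs twice the rank of the error, and by Parseval only few entries of [D]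
   are large. *)
Lemma toeplitz_approx (X : finType) (phi : X -> H) (g : H -> C) (E : H -> H -> C)
    (r L B : R) :
  injective phi -> (forall h, nc (g h) <= 1) -> 0 < B -> 0 <= L ->
  rk_le (fun x y => F x y - E x y) r ->
  nrm_le E (Num.sqrt #|H|%:R * L) ->
  exists E' : X -> X -> C,
    rk_le (fun x y => g (phi x - phi y) - E' x y)
      (#|H|%:R ^+ 2 / B ^+ 2 + (r + r)) /\
    nrm_le E' (L ^+ 2 * B).
Proof.
move=> phi_inj g1 B0 L0 hr hE.
(* Parseval bounds the sum of the squared coefficients by [#|H|^2], so at most [#|H|^2 / B^2] of
   them exceed [B]. *)
pose big k := B < nc (fhat g k).
pose D k : C := if big k then 0 else M^-1 * fhat g k.
pose G x k := F (phi x) k; pose S x k := E (phi x) k.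
pose Gs k y := conjc (G y k); pose Ss k y := conjc (S y k).
exists (fun x y => \sum_k S x k * (D k * Ss k y)); split.
  have hbig : #|[pred k | big k]|%:R <= #|H|%:R ^+ 2 / B ^+ 2 :> R.
    rewrite ler_pdivlMr ?exprn_gt0 // -sum1_card natr_sum mulr_suml.
    apply: (@le_trans _ _ (\sum_k nc (fhat g k) ^+ 2)).
      rewrite big_mkcond; apply: ler_sum => k _; rewrite inE /big /=.
      case: ifP => hk; last exact: sqr_ge0.
      by rewrite mul1r lerXn2r ?nnegrE ?nc_ge0 ?ltW.
    rewrite parseval [leRHS]expr2 ler_wpM2l //.
    apply: (@le_trans _ _ (\sum_(h : H) 1)); last by rewrite sumr_const.
    by apply: ler_sum => h _; rewrite exprn_ile1 ?nc_ge0.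
  have rd : rk_le (fun x k => G x k - S x k) r.
    exact: (rk_le_sub phi id hr).
  (* The error splits into the large diagonal entries, [(G - S) D] times the adjoint of [G], and
     [S D] times the adjoint of [G - S]. *)
  have r1 := rk_le_diag G Gs (d := fun k => if big k then M^-1 * fhat g k else 0)
    (P := [pred k | big k]) _.
  have r2 := rk_le_mulr (fun k y => D k * Gs k y) rd.
  have r3 := rk_le_mull (fun x k => S x k * D k) (rk_le_adjoint rd).
  apply: rk_leW (lerD hbig (lexx _)) _.
  apply: eq_rk (rk_leD (r1 _) (rk_leD r2 r3)) => [x y|k /=]; last first.
    by move/negbTE ->.
  rewrite toeplitz_expand /kmul -!big_split -sumrB /=; apply: eq_bigr => k _.
  rewrite /D /Gs /Ss /G rmorphB /=; case: ifP => _; ring.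
have Mr : 0 < #|H|%:R :> R by rewrite ltr0n; apply/card_gt0P; exists 0.
have nS : nrm_le S (Num.sqrt #|H|%:R * L).
  exact: (nrm_le_sub phi_inj (@inj_id H) hE).
(* The remaining diagonal entries are at most [B / #|H|], which cancels the two factors [sqrt #|H|]
   coming from [S] and its adjoint. *)
have BM : 0 <= #|H|%:R^-1 * B by rewrite mulr_ge0 ?invr_ge0 ?ltW.
have sL : 0 <= Num.sqrt #|H|%:R * L by rewrite mulr_ge0.
have nD k : nc (D k) <= #|H|%:R^-1 * B.
  rewrite /D; case: ifP => [_|/negbT]; first by rewrite Normc.normc0.
  by rewrite -leNgt Normc.normcM Normc.normcV nc_nat => h; rewrite ler_wpM2l // invr_ge0.
have n2 := nrm_le_mull BM nD (nrm_le_adjoint nS).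
apply: nrm_leW (nrm_le_mul sL (mulr_ge0 BM sL) nS n2).
have sq : Num.sqrt (#|H|%:R : R) ^+ 2 = #|H|%:R by rewrite sqr_sqrtr.
have -> : Num.sqrt #|H|%:R * L * (#|H|%:R^-1 * B * (Num.sqrt #|H|%:R * L)) =
   (Num.sqrt (#|H|%:R : R) ^+ 2) * #|H|%:R^-1 * (L ^+ 2 * B) by ring.
by rewrite sq divff ?mul1r // gt_eqF.
Qed.

End FourierTransform.
End Toeplitz.

(** * Embedding cyclic groups by digits *)

Section DigitEmbedding.
Variable R : realType.
Local Notation C := R[i].

(** [theta] records the residues modulo all members of [ps]; the Chinese remainder theorem recovers
    the residue modulo their product. *)
Lemma digit_group (s : R) (ps : seq nat) : 1 <= s ->
  all (fun p => 0 < p)%N ps -> all (fun p => Num.sqrt p%:R <= s) ps ->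
  pairwise coprime ps ->
  exists (H : finZmodType) (F : H -> H -> C) (theta : nat -> H),
    [/\ fsys s (size ps) F, #|H| = (\prod_(p <- ps) p)%N,
      forall a b, theta (a + b)%N = theta a + theta b
    & forall a b, theta a = theta b -> a = b %[mod \prod_(p <- ps) p]].
Proof.
move=> s1; elim: ps => [|p ps IHps] /=.
  move=> _ _ _; exists 'I_1, (fun _ _ => 1), (fun=> 0); split=> //.
  - exact: fsys_unit.
  - by rewrite card_ord big_nil.
  - by move=> a b; rewrite addr0.
  - by move=> a b _; rewrite big_nil !modn1.
case: p => [//|p] /= ps0 /andP[ps1 ps2] /andP[co1 co2].
have [H [F [theta [f cH thD thI]]]] := IHps ps0 ps2 co2.
exists ('I_p.+1 * H)%type, (tens (@zkern R p) F), (fun a => (inZp a, theta a)); split.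
- by rewrite -add1n; apply: fsys_tens f; [lra|exact: fsys_cyclic].
- by rewrite card_prod card_ord cH big_cons.
- move=> a b; rewrite thD; congr pair; apply: val_inj => /=.
  by rewrite modnDm.
- move=> a b [ab /thI tab]; rewrite big_cons; apply/eqP.
  rewrite chinese_remainder ?ab ?tab ?eqxx //.
  elim: (ps) co1 => [|p' l IHl] /=; first by rewrite big_nil coprimen1.
  by move=> /andP[h1 h2]; rewrite big_cons coprimeMr h1 IHl.
Qed.

(* Digit-wise differences determine the integer difference although not
   conversely: carries are harmless in this direction. *)
Lemma digits_embedding (s : R) m q r (H0 : finZmodType) (F0 : H0 -> H0 -> C)
    (theta : nat -> H0) k :
  0 <= s -> (0 < r)%N -> (2 * r <= q)%N ->
  fsys s m F0 -> #|H0| = q ->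
  (forall a b, theta (a + b)%N = theta a + theta b) ->
  (forall a b, theta a = theta b -> a = b %[mod q]) ->
  exists (H : finZmodType) (F : H -> H -> C) (phi : nat -> H),
    [/\ fsys s (m * k) F, #|H| = (q ^ k)%N
    & forall a b a' b', (a < r ^ k)%N -> (b < r ^ k)%N -> (a' < r ^ k)%N ->
       (b' < r ^ k)%N -> phi a + phi b' = phi a' + phi b -> (a + b' = a' + b)%N].
Proof.
move=> s0 r0 rq f0 c0 thD thI; elim: k => [|k [H [F [phi [f cH phiI]]]]].
  exists 'I_1, (fun _ _ => 1), (fun=> 0); split=> [||a b a' b'].
  - by rewrite muln0; exact: fsys_unit.
  - by rewrite card_ord.
  - by rewrite expn0 !ltnS !leqn0 => /eqP-> /eqP-> /eqP-> /eqP->.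
(* The lowest digit is sent to [H0], the remaining ones recursively to [H]. *)
exists (H0 * H)%type, (tens F0 F), (fun a => (theta (a %% r)%N, phi (a %/ r)%N)); split.
- by rewrite mulnS; apply: fsys_tens f.
- by rewrite card_prod c0 cH expnS.
move=> a b a' b' ha hb ha' hb' [h1 h2].
have dl x : (x < r ^ k.+1)%N -> (x %/ r < r ^ k)%N by rewrite ltn_divLR // -expnSr.
have {h2} h2 := phiI _ _ _ _ (dl _ ha) (dl _ hb) (dl _ ha') (dl _ hb') h2.
move: h1; rewrite -!thD => /thI.
(* A sum of two digits stays below [2 r <= q], so congruence modulo [q] is equality. *)
have lt2 x y : (x %% r + y %% r < q)%N.
  apply: leq_trans rq; rewrite mul2n -addnn -addSn.
  by apply: leq_add; [rewrite ltn_mod|apply: ltnW; rewrite ltn_mod].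
rewrite !(modn_small (lt2 _ _)) => h1.
rewrite (divn_eq a r) (divn_eq b r) (divn_eq a' r) (divn_eq b' r).
rewrite addnACA -mulnDl h2 h1 mulnDl; by rewrite addnACA.
Qed.

(* The last inequality bounds what is lost by replacing [X] with the larger group
   [H]; it must be beaten by the rank saving, which is exponential in [m * K]. *)
Definition toep (s : R) m q K (X : finType) (T : X -> X -> C) : Prop :=
  exists (H : finZmodType) (F : H -> H -> C) (phi : X -> H) (g : H -> C),
    [/\ fsys s (m * K) F, #|H| = (q ^ K)%N, injective phi,
      forall h, nc (g h) <= 1
    & (forall x y, T x y = g (phi x - phi y)) /\ (q ^ K <= 9 ^ K * #|X|)%N].

Lemma toep_tens (s : R) m q K K' (X X' : finType) (T : X -> X -> C) (T' : X' -> X' -> C) :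
  0 <= s -> toep s m q K T -> toep s m q K' T' -> toep s m q (K + K') (tens T T').
Proof.
move=> s0 [H [F [phi [g [f cH pI g1 [TE hq]]]]]].
move=> [H' [F' [phi' [g' [f' cH' pI' g1' [TE' hq']]]]]].
exists (H * H')%type, (tens F F'), (fun x => (phi x.1, phi' x.2)),
  (fun h => g h.1 * g' h.2); split.
- by rewrite mulnDr; apply: fsys_tens.
- by rewrite card_prod cH cH' expnD.
- by move=> [x x'] [y y'] /= [/pI -> /pI' ->].
- by move=> h; rewrite Normc.normcM -[1]mulr1 ler_pM ?nc_ge0.
split=> [x y|]; first by rewrite /tens TE TE'.
by rewrite !expnD card_prod mulnACA leq_mul.
Qed.

Lemma toep_unit (s : R) m q : toep s m q 0 (fun _ _ : 'I_1 => 1).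
Proof.
exists 'I_1, (fun _ _ => 1), id, (fun=> 1); split=> //.
- by rewrite muln0; exact: fsys_unit.
- by rewrite card_ord.
- by move=> h; rewrite nc1.
by split=> //; rewrite card_ord.
Qed.

(* [2 x y = x ^ 2 + y ^ 2 - (x - y) ^ 2] turns the Fourier matrix of a cyclic
   group into a Toeplitz matrix, up to unimodular row and column scalings. *)
Lemma zkern_chirp p (x y : 'I_p.+1) :
  zkern R x y = e2pi ((x : nat)%:R ^+ 2 / (2 * p.+1%:R)) *
    e2pi (- ((x : nat)%:R - (y : nat)%:R) ^+ 2 / (2 * p.+1%:R)) *
    e2pi ((y : nat)%:R ^+ 2 / (2 * p.+1%:R)).
Proof.
rewrite zkernE -!e2piD natrM; congr e2pi; field.
by rewrite addrC natr1 pnatr_eq0.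
Qed.

(** Here [K] is the least number of base [r] digits that suffices. A group of order above [r ^ r]
    needs more than [r] digits, which makes the rounding loss in the top digit negligible. *)
Lemma zkern_toep (s : R) m q r (H0 : finZmodType) (F0 : H0 -> H0 -> C)
    (theta : nat -> H0) p :
  0 <= s -> (1 < r)%N -> (2 * r <= q <= 3 * r)%N ->
  fsys s m F0 -> #|H0| = q ->
  (forall a b, theta (a + b)%N = theta a + theta b) ->
  (forall a b, theta a = theta b -> a = b %[mod q]) ->
  (r ^ r < p.+1)%N ->
  exists K (u : 'I_p.+1 -> C) (T : 'I_p.+1 -> 'I_p.+1 -> C),
    [/\ toep s m q K T, forall x, nc (u x) = 1
      & forall x y, zkern R x y = u x * T x y * u y].
Proof.
move=> s0 r1 /andP[rq qr] f0 c0 thD thI rp.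
have r0 : (0 < r)%N by exact: ltnW.
have ex : exists k, (p.+1 <= r ^ k)%N.
  by exists p.+1; apply: ltnW; apply: ltn_expl.
have [k pk mink] := ex_minnP ex.
have k0 : (0 < k)%N.
  case: k pk {mink} => //; rewrite expn0 => pk; have := leq_trans rp pk.
  by rewrite ltnS leqn0 expn_eq0; case: (r) r0.
have rk : (r < k)%N.
  by rewrite -(ltn_exp2l _ _ r1); apply: leq_trans rp pk.
have pk1 : (r ^ k.-1 < p.+1)%N.
  by rewrite ltnNge; apply/negP => /mink; rewrite leqNgt prednK // leqnn.
have [H [F [phi [f cH phiI]]]] := digits_embedding k s0 r0 rq f0 c0 thD thI.
pose T (x y : 'I_p.+1) : C := e2pi (- ((x : nat)%:R - (y : nat)%:R) ^+ 2 / (2 * p.+1%:R)).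
exists k, (fun x => e2pi ((x : nat)%:R ^+ 2 / (2 * p.+1%:R))), T; split; last first.
- exact: zkern_chirp.
- by move=> x; rewrite nc_e2pi.
have lt (x : 'I_p.+1) : (x < r ^ k)%N by exact: leq_trans (ltn_ord x) pk.
(* The choice of representatives is harmless: equal differences of [phi] come from equal integer
   differences, on which alone [T] depends. Off the set of differences [g] is 0. *)
pose g h : C := if [pick ab : 'I_p.+1 * 'I_p.+1 | phi ab.1 - phi ab.2 == h] is Some ab
  then T ab.1 ab.2 else 0.
exists H, F, (fun x : 'I_p.+1 => phi x), g; split=> //.
- move=> x y /= pxy; apply: val_inj => /=; have := phiI x y y y (lt _) (lt _) (lt _) (lt _).
  by rewrite pxy => /(_ erefl) /addIn.
- by move=> h; rewrite /g; case: pickP => [ab _|_]; rewrite ?nc_e2pi ?Normc.normc0.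
split=> [x y|].
  rewrite /g; case: pickP => [[a b] /= /eqP h|/(_ (x, y))]; last by rewrite eqxx.
  have : phi a + phi y = phi x + phi b.
    by rewrite -[phi a](subrK (phi b)) h addrAC subrK.
  move=> /(phiI _ _ _ _ (lt a) (lt b) (lt x) (lt y)) aybx.
  rewrite /T; have -> // : (x : nat)%:R - (y : nat)%:R = (a : nat)%:R - (b : nat)%:R :> R.
  have := congr1 (fun z => z%:R : R) aybx; rewrite !natrD; lra.
(* One factor [3^k] comes from [q <= 3 r]. The other absorbs [r^k <= r (p + 1)], since
   [r <= 3^r <= 3^k]. *)
rewrite card_ord; apply: (@leq_trans ((3 * r) ^ k)); first by rewrite leq_exp2r.
rewrite (_ : 9 = 3 * 3)%N // !expnMn -mulnA leq_mul2l; apply/orP; right.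
rewrite -{1}(prednK k0) expnS; apply: leq_mul; last exact: ltnW.
apply: (leq_trans (ltnW (ltn_expl r (isT : 1 < 3)%N))).
by rewrite leq_exp2l // ltnW.
Qed.

End DigitEmbedding.

(** * Choice of the parameters *)

Section Approximable.
Variable R : realType.
Local Notation C := R[i].

Lemma sqrt_expR (x : R) : Num.sqrt (expR x) = expR (2^-1 * x).
Proof.
apply/eqP; rewrite -(eqrXn2 (n := 2)) ?sqrtr_ge0 ?expR_ge0 //.
by rewrite sqr_sqrtr ?expR_ge0 // expr2 -expRD -mulrDl -[2^-1]mul1r -splitr mul1r.
Qed.

(* The factor [expR c] absorbs constants, and [ln #|X|%:R] makes all later
   estimates linear in the exponents. *)
Definition approximable (eta a c : R) (X : finType) (K : X -> X -> C) : Prop :=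
  exists E : X -> X -> C,
    rk_le (fun x y => K x y - E x y) (expR (c + (1 - a) * ln #|X|%:R)) /\
    nrm_le E (expR (c + (2^-1 + eta) * ln #|X|%:R)).

Lemma ln_nat_ge0 n : (0 < n)%N -> 0 <= ln (n%:R : R).
Proof. by move=> n0; rewrite ln_ge0 // (ler_nat R 1). Qed.

Lemma lnMn n n' : (0 < n)%N -> (0 < n')%N -> ln ((n * n')%:R : R) = ln n%:R + ln n'%:R.
Proof. by move=> n0 n0'; rewrite natrM lnM // posrE ltr0n. Qed.

Lemma approximableW eta a c eta' a' c' (X : finType) (K : X -> X -> C) : (0 < #|X|)%N ->
  eta <= eta' -> a' <= a -> c <= c' -> approximable eta a c K -> approximable eta' a' c' K.
Proof.
move=> X0 he ha hc [E [h1 h2]]; have L0 := ln_nat_ge0 X0.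
by exists E; split; [apply: rk_leW h1|apply: nrm_leW h2]; rewrite ler_expR; nra.
Qed.

(** Telescoping: replace one tensor factor at a time. *)
Lemma rk_le_tensB (X Y : finType) (K E : X -> X -> C) (K' E' : Y -> Y -> C) r r' :
  rk_le (fun x y => K x y - E x y) r -> rk_le (fun x y => K' x y - E' x y) r' ->
  rk_le (fun x y => tens K K' x y - tens E E' x y) (r * #|Y|%:R + #|X|%:R * r').
Proof.
move=> h h'.
apply: eq_rk (rk_leD (rk_le_tens h (rk_le_card K')) (rk_le_tens (rk_le_card E) h')).
by move=> x y; rewrite /tens; ring.
Qed.

(** A factor holding at most a share [eta] of the total logarithm is kept whole, and its trivial
    norm fits into the second [eta]. Otherwise both factors are approximated, and each saves at
    least [a * eta] of the total. *)
Lemma approximable_tens eta a c (X Y : finType) (K : X -> X -> C) (K' : Y -> Y -> C) :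
  (0 < #|X|)%N -> (0 < #|Y|)%N -> 0 < eta <= 2^-1 -> 0 < a -> 0 <= c ->
  (forall x y, nc (K x y) <= 1) -> (forall x y, nc (K' x y) <= 1) ->
  approximable eta a c K -> approximable eta a c K' ->
  approximable (2 * eta) (a * eta) (2 * c + ln 2) (tens K K').
Proof.
move=> X0 Y0 /andP[eta0 eta1] a0 c0 nK nK' [E [h1 h2]] [E' [h1' h2']].
have X1 : #|X|%:R = expR (ln #|X|%:R) :> R by rewrite lnK // posrE ltr0n.
have Y1 : #|Y|%:R = expR (ln #|Y|%:R) :> R by rewrite lnK // posrE ltr0n.
have ln2 : 0 <= ln (2 : R) by rewrite ln_ge0 // ler1n.
have := ln_nat_ge0 X0; have := ln_nat_ge0 Y0.
rewrite /approximable card_prod lnMn //.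
move: X1 Y1 h1 h2 h1' h2'; set L := ln #|X|%:R; set L' := ln #|Y|%:R.
move=> X1 Y1 h1 h2 h1' h2' L'0 L0.
have eL : 0 <= eta * L by rewrite mulr_ge0 // ltW.
have eL' : 0 <= eta * L' by rewrite mulr_ge0 // ltW.
have eS : 0 <= (1 - 2 * eta) * (L + L') by rewrite mulr_ge0 //; lra.
have aS z : eta * (L + L') <= z -> 0 <= a * (z - eta * (L + L')).
  by move=> h; rewrite mulr_ge0 ?subr_ge0 // ltW.
have [sX|sX] := lerP L (eta * (L + L')).
  have := aS L' ltac:(lra) => aS'.
  exists (tens K E'); split.
    apply: (@rk_leW _ _ _ _ (#|X|%:R * expR (c + (1 - a) * L'))).
      by rewrite X1 -expRD ler_expR; lra.
    by apply: eq_rk (rk_le_tens (rk_le_card K) h1') => x y; rewrite /tens; ring.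
  apply: nrm_leW (nrm_le_tens (nrm_le_trivial nK) h2').
  by rewrite X1 -expRD ler_expR; lra.
have aSX := aS _ (ltW sX).
have [sY|sY] := lerP L' (eta * (L + L')).
  exists (tens E K'); split.
    apply: (@rk_leW _ _ _ _ (expR (c + (1 - a) * L) * #|Y|%:R)).
      by rewrite Y1 -expRD ler_expR; lra.
    by apply: eq_rk (rk_le_tens h1 (rk_le_card K')) => x y; rewrite /tens; ring.
  apply: nrm_leW (nrm_le_tens h2 (nrm_le_trivial nK')).
  by rewrite Y1 -expRD ler_expR; lra.
have aSY := aS _ (ltW sY).
exists (tens E E'); split; last first.
  apply: nrm_leW (nrm_le_tens h2 h2').
  by rewrite -expRD ler_expR; lra.
apply: rk_leW (rk_le_tensB h1 h1').
rewrite X1 Y1 -!expRD.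
apply: (@le_trans _ _ (2 * expR (c + (L + L') - a * eta * (L + L')))).
  have e1 : expR (c + (1 - a) * L + L') <= expR (c + (L + L') - a * eta * (L + L')).
    by rewrite ler_expR; lra.
  have e2 : expR (L + (c + (1 - a) * L')) <= expR (c + (L + L') - a * eta * (L + L')).
    by rewrite ler_expR; lra.
  lra.
by rewrite -{1}[2]lnK ?posrE // -expRD ler_expR; lra.
Qed.

(** The lower bound [2 ^ n] on the order pays for the norm, which is exponential in [n] with a small
    rate; the upper bound [q ^ n] turns the rank saving [e^2 n / 36] into a power of the order. *)
Lemma approximable_fsys (s eta : R) (q : nat) : 1 <= s -> 0 < eta -> (1 < q)%N ->
  exists a c : R, [/\ 0 < a, 0 <= c &
    forall n (H : finZmodType) (F : H -> H -> C), fsys s n F ->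
      (2 ^ n <= #|H| <= q ^ n)%N -> approximable eta a c F].
Proof.
move=> s1 eta0 q1.
have l2 : 0 < ln (2 : R) by rewrite ln_gt0 // ltr1n.
have lq : 0 < ln (q%:R : R) by rewrite ln_gt0 // ltr1n.
pose A := 16 * s.
(* The goal is [2 e Q <= eta ln 2]. Taking [e = d^2] and [ln x <= x - 1] at [A / d] gives
   [Q <= 2 A / d], hence [2 e Q <= 4 A d]. *)
pose d := Num.min 2^-1 (eta * ln 2 / (4 * A)).
have A16 : 16 <= A by rewrite /A; lra.
have d0 : 0 < d by rewrite lt_min divr_gt0 ?mulr_gt0 //=; lra.
have d1 : d <= 2^-1 by rewrite /d ge_min lexx.
have d2 : d * (4 * A) <= eta * ln 2.
  by rewrite -ler_pdivlMr; [rewrite ge_min lexx orbT|lra].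
pose e := d ^+ 2.
have e0 : 0 < e by rewrite exprn_gt0.
have e1 : e <= 2^-1 by rewrite /e; nra.
pose Q := ln (16 * s / e) + 1.
have Ad : 1 <= A / d by rewrite ler_pdivlMr; lra.
have Q2 : Q <= 2 * (A / d).
  have -> : Q = ln (A / e) + 1 by [].
  have le : ln (A / e) <= ln ((A / d) ^+ 2).
    rewrite ler_ln ?posrE ?divr_gt0 ?exprn_gt0 ?divr_gt0 //; try lra.
    rewrite /e expr_div_n ler_wpM2r ?invr_ge0 ?sqr_ge0 //; nra.
  move: le; rewrite lnXn; last by lra.
  have := @le_ln1Dx R (A / d - 1) ltac:(lra); rewrite addrC subrK.
  rewrite -mulr_natl; lra.
have Q0 : 0 <= Q.
  rewrite addr_ge0 // ln_ge0 // ler_pdivlMr //; lra.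
have eQ : 2 * e * Q <= eta * ln 2.
  apply: le_trans d2.
  have -> : d * (4 * A) = 2 * e * (2 * (A / d)) by rewrite /e; field; rewrite gt_eqF.
  by rewrite ler_wpM2l // mulr_ge0 // ltW.
pose a := e ^+ 2 / (36 * ln (q%:R : R)).
have a0 : 0 < a by rewrite divr_gt0 ?exprn_gt0 // mulr_gt0.
have aq : a * ln q%:R = e ^+ 2 / 36 by rewrite /a; field; rewrite gt_eqF.
exists a, (ln 2 + Q); split=> //.
- lra.
move=> n H F f /andP[Hn1 Hn2].
have H0 : (0 < #|H|)%N by apply: leq_trans Hn1; rewrite expn_gt0.
have H1 : #|H|%:R = expR (ln #|H|%:R) :> R by rewrite lnK // posrE ltr0n.
have L1 : n%:R * ln 2 <= ln (#|H|%:R : R).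
  have -> : n%:R * ln 2 = ln ((2 ^ n)%:R : R) by rewrite natrX lnXn // mulr_natl.
  by rewrite ler_ln ?posrE ?ltr0n ?expn_gt0 // ler_nat.
have L2 : ln (#|H|%:R : R) <= n%:R * ln q%:R.
  have q0 : 0 < q%:R :> R by rewrite ltr0n ltnW.
  have -> : n%:R * ln q%:R = ln ((q ^ n)%:R : R) by rewrite natrX lnXn // mulr_natl.
  by rewrite ler_ln ?posrE ?ltr0n ?expn_gt0 ?(ltnW q1) // ler_nat.
have [E [h1 h2]] := fsys_approx f s1 (e := e) ltac:(by rewrite e0 e1).
rewrite /approximable; move: (ln #|H|%:R) H1 L1 L2 => L H1 L1 L2.
have n0 : 0 <= n%:R :> R by [].
exists E; split.
  apply: rk_leW h1; rewrite H1 -{1}[2]lnK ?posrE // -!expRD ler_expR.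
  have aL : 0 <= a * (n%:R * ln q%:R - L) by rewrite mulr_ge0 ?subr_ge0 // ltW.
  have aqn : a * (n%:R * ln q%:R) = e ^+ 2 * n%:R / 36 by rewrite mulrCA aq; lra.
  move: aL aqn Q0; move: (ln q%:R) (ln 2) => lq' l2'; lra.
apply: nrm_leW h2.
have -> : Num.sqrt (#|H|%:R : R) = expR (2^-1 * L).
  by rewrite H1 sqrt_expR.
rewrite -expRD ler_expR -/Q; nra.
Qed.

End Approximable.

(** * Parameters for large cyclic groups *)

Section LargeCyclic.
Variable R : realType.
Local Notation C := R[i].

(* Goedel's beta-function moduli [1 + (i + 1) T] with [m! | T]. *)
Lemma coprime_family (m B : nat) : exists P (ps : seq nat),
  [/\ (B <= P)%N, (1 < P)%N, size ps = m, pairwise coprime ps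
    & all (fun p => P <= p <= P ^ 2)%N ps].
Proof.
pose T := (m.+1`! * B.+1)%N.
have T0 : (0 < T)%N by rewrite muln_gt0 fact_gt0.
have mT : (m <= T)%N.
  apply: (@leq_trans m.+1`!); last by rewrite leq_pmulr.
  apply: (@leq_trans m.+1) => //; exact: fact_geq.
exists T.+1, [seq (i.+1 * T).+1 | i <- iota 0 m]; split.
- by rewrite ltnW // ltnS; apply: (@leq_trans B.+1) => //; rewrite leq_pmull ?fact_gt0.
- by rewrite ltnS.
- by rewrite size_map size_iota.
- rewrite pairwise_map; apply: (@sub_in_pairwise _ (fun i => i < m)%N ltn).
  + move=> i j; rewrite -!topredE /= => im jm ij; rewrite /coprime -dvdn1.
    set d := gcdn _ _.
    have di : (d %| (i.+1 * T).+1)%N by exact: dvdn_gcdl.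
    have dj : (d %| (j.+1 * T).+1)%N by exact: dvdn_gcdr.
    have coT : coprime d T.
      apply: (coprime_dvdl di); rewrite -addn1 /coprime.
      by rewrite gcdnC gcdnMDl gcdn1.
    have dji : (d %| j - i)%N.
      rewrite -(Gauss_dvdl _ coT) mulnBl.
      have -> : (j * T - i * T = (j.+1 * T).+1 - (i.+1 * T).+1)%N.
        by rewrite subSS !mulSn subnDl.
      by rewrite dvdn_sub.
    have dT : (d %| T)%N.
      apply: (dvdn_trans dji); apply: dvdn_mulr; apply: dvdn_fact.
      by rewrite subn_gt0 ij /=; apply: leq_trans (leq_subr _ _) (leqW (ltnW jm)).
    by rewrite dvdn1; move: coT; rewrite /coprime (gcdn_idPl dT).
  + by apply/allP => i; rewrite mem_iota.
  + by have := iota_ltn_sorted 0 m; rewrite sorted_pairwise //; exact: ltn_trans.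
apply/allP => p /mapP [i + ->]; rewrite mem_iota add0n => im; apply/andP; split.
  by rewrite ltnS leq_pmull.
apply: (@leq_trans (T * T).+1); last by rewrite -mulnn ltn_mul.
by rewrite ltnS leq_mul2r (leq_trans im mT) orbT.
Qed.

(** The embedding loses a factor [9^K] in the order, which the third numerical hypothesis on
    logarithms bounds in [q] terms by a small power of [#|X|]. The condition on [m] gives a rank
    saving of [9^(2K)]: half repays the embedding, half is the gain. *)
Lemma approximable_toep (eta : R) m q P K (X : finType) (T : X -> X -> C) :
  0 < eta <= 1 -> (0 < #|X|)%N -> (0 < P)%N -> (1 < q)%N ->
  ln (16 / (eta / 64)) + 1 <= ln (P%:R : R) ->
  ln 9 * (1 + eta / 4) <= eta / 4 * ln (q%:R : R) ->
  m%:R * ln P%:R <= ln (q%:R : R) ->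
  72 * ln 9 <= (eta / 64) ^+ 2 * m%:R ->
  toep P%:R m q K T ->
  approximable eta (Num.min (eta / 4) (ln 9 / ln q%:R)) (ln 5 + 4 * ln P%:R) T.
Proof.
move=> /andP[eta0 eta1] X0 P0 q1 hP hq hm he [H [F [phi [g [f cH pI g1 [TE hqK]]]]]].
set k := eta / 4 in hq *; set e := eta / 64 in hP he.
have P1 : 1 <= (P%:R : R) by rewrite (ler_nat R 1).
have e0 : 0 < e by rewrite /e; lra.
have e2 : e <= 2^-1 by rewrite /e; lra.
have l9 : 0 < ln (9 : R) by rewrite ln_gt0 // ltr1n.
have l5 : 0 < ln (5 : R) by rewrite ln_gt0 // ltr1n.
have lP : 0 <= ln (P%:R : R) by apply: ln_nat_ge0.
have lq : 0 < ln (q%:R : R) by rewrite ln_gt0 // ltr1n.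
have qK : (q ^ K)%:R = expR (K%:R * ln q%:R) :> R.
  by rewrite natrX mulrC expRM_natr lnK // posrE ltr0n ltnW.
have X1 : #|X|%:R = expR (ln #|X|%:R) :> R by rewrite lnK // posrE ltr0n.
have LM1 : ln #|X|%:R <= K%:R * ln q%:R :> R.
  by rewrite -ler_expR -qK -X1 ler_nat -cH (leq_card phi).
have LM2 : K%:R * ln q%:R <= K%:R * ln 9 + ln #|X|%:R :> R.
  rewrite -ler_expR expRD -X1 -qK [K%:R * _]mulrC expRM_natr.
  by rewrite lnK ?posrE // -natrX -natrM ler_nat.
have L0 : 0 <= ln (#|X|%:R : R) by apply: ln_nat_ge0.
have [E [h1 h2]] := fsys_approx f P1 (e := e) ltac:(by rewrite e0 e2).
(* The threshold is [#|H|^(1/2 + k)], so only [#|H|^(1 - 2k)] coefficients are discarded. *)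
have [E' [r1 r2]] := toeplitz_approx f (B := expR ((2^-1 + k) * (K%:R * ln q%:R)))
  pI g1 (expR_gt0 _) (expR_ge0 _) h1 h2.
have Q0 : 0 <= ln (16 * P%:R / e) + 1.
  by rewrite addr_ge0 // ln_ge0 // ler_pdivlMr //; lra.
have Q1 : ln (16 * P%:R / e) + 1 <= 2 * ln P%:R.
  have -> : 16 * P%:R / e = 16 / e * P%:R by ring.
  rewrite lnM ?posrE ?divr_gt0 ?ltr0n //; lra.
have n0 : 0 <= K%:R :> R by [].
have K9 : K%:R * ln 9 <= k * ln (#|X|%:R : R).
  have := ler_wpM2l n0 hq; have k0 : 0 <= k by rewrite /k; lra.
  have := ler_wpM2l k0 LM2; lra.
rewrite /approximable.
exists E'; split.
  apply: rk_leW (eq_rk _ r1) => [|x y]; last by rewrite TE.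
  rewrite cH qK natrM; move: (ln #|X|%:R) (ln q%:R) LM1 LM2 L0 lq hq hm K9.
  move=> L lq' LM1 LM2 L0 lq0 hq hm K9.
  set a := Num.min _ _.
  have ak : a <= k by rewrite /a ge_min lexx.
  have aq : a * lq' <= ln 9.
    by rewrite -ler_pdivlMr // /a ge_min lexx orbT.
  have a0 : 0 <= a.
    by rewrite /a le_min; apply/andP; split; [rewrite /k; lra|exact: divr_ge0 (ltW l9) (ltW lq0)].
  have aL : a * L <= K%:R * ln 9.
    have := ler_wpM2l a0 LM1; have := ler_wpM2l n0 aq; lra.
  (* The 5 is 1 for the large coefficients plus 2 for each of the two errors in [F]. *)
  apply: (@le_trans _ _ (5 * expR ((1 - a) * L))); last first.
    by rewrite -{1}[5]lnK ?posrE // -expRD ler_expR; lra.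
  have -> : expR (K%:R * lq') ^+ 2 / expR ((2^-1 + k) * (K%:R * lq')) ^+ 2 =
     expR ((1 - 2 * k) * (K%:R * lq')).
    by rewrite -!expRM_natl -expRN -expRD; congr expR; field.
  have i1 : expR ((1 - 2 * k) * (K%:R * lq')) <= expR ((1 - a) * L).
    rewrite ler_expR.
    have k1 : 0 <= 1 - 2 * k by rewrite /k; lra.
    have h : K%:R * lq' <= (1 + k) * L by lra.
    have := ler_wpM2l k1 h; have := ler_wpM2r L0 ak.
    have : 0 <= k ^+ 2 * L by rewrite mulr_ge0 ?sqr_ge0.
    lra.
  have i2 : 2 * expR (K%:R * lq') * expR (- (e ^+ 2 * (m%:R * K%:R) / 36))
      <= 2 * expR ((1 - a) * L).
    rewrite -mulrA ler_wpM2l // -expRD ler_expR.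
    have := ler_wpM2r n0 he; lra.
  lra.
apply: nrm_leW r2.
rewrite -expRM_natl -expRD ler_expR natrM.
have mK : 0 <= m%:R * K%:R :> R by rewrite mulr_ge0.
have t0 : 0 <= 2 * e * (m%:R * K%:R) + 1 by rewrite addr_ge0 ?mulr_ge0 // ltW.
have h3 := ler_wpM2l t0 Q1.
have h4 := ler_wpM2l (ltW e0) (ler_wpM2l n0 hm).
have h5 : K%:R * ln q%:R <= (1 + k) * ln (#|X|%:R : R) by lra.
have k0 : 0 <= 8 * e + (2^-1 + k) by rewrite /e /k; lra.
have h6 := ler_wpM2l k0 h5.
have h7 : (8 * e + (2^-1 + k)) * (1 + k) <= 2^-1 + eta by rewrite /e /k; nra.
have h8 := ler_wpM2r L0 h7.
lra.
Qed.

(** Order of choice: [m] depends only on [eta], then the moduli are taken large in terms of [eta],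
    and [q] is their product. All lie between [P] and [P^2], so [s = P] bounds their square roots
    while [q >= P^m]. *)
Lemma large_cyclic_parameters (eta : R) : 0 < eta <= 1 ->
  exists (s a c : R) (q r m : nat) (H0 : finZmodType) (F0 : H0 -> H0 -> C)
    (theta : nat -> H0),
  [/\ [/\ 1 <= s, 0 < a & 0 <= c], (1 < r)%N /\ (2 * r <= q <= 3 * r)%N,
     fsys s m F0 /\ #|H0| = q,
     (forall a b, theta (a + b)%N = theta a + theta b) /\
     (forall a b, theta a = theta b -> a = b %[mod q])
   & forall K (X : finType) (T : X -> X -> C), (0 < #|X|)%N ->
       toep s m q K T -> approximable eta a c T].
Proof.
move=> /andP[eta0 eta1].
have l9 : 0 < ln (9 : R) by rewrite ln_gt0 // ltr1n.
have l5 : 0 < ln (5 : R) by rewrite ln_gt0 // ltr1n.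
set e := eta / 64; set k := eta / 4.
have e0 : 0 < e by rewrite /e; lra.
have k0 : 0 < k by rewrite /k; lra.
pose m := (Num.trunc (72 * ln 9 / e ^+ 2)).+1.
have hm : 72 * ln 9 <= e ^+ 2 * m%:R.
  by rewrite [leRHS]mulrC -ler_pdivrMr ?exprn_gt0 //; apply/ltW/truncnS_gt.
(* The added 4 forces [q >= 4], so that [r = q / 2] is at least 2. *)
pose B := (Num.trunc (expR (ln (16 / e) + 1) + expR (ln 9 * (1 + k) / k))).+4.
have hB : expR (ln (16 / e) + 1) + expR (ln 9 * (1 + k) / k) <= B%:R.
  by apply: le_trans (ltW (truncnS_gt _)) _; rewrite ler_nat !ltnS; do 3!apply: leqW.
have [P [ps [BP P1 sps cops bps]]] := coprime_family m B.
have BPr : B%:R <= P%:R :> R by rewrite ler_nat.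
have Pp : (P%:R : R) \is Num.pos by rewrite posrE ltr0n ltnW.
have hP1 : ln (16 / e) + 1 <= ln (P%:R : R).
  rewrite -ler_expR [expR (ln P%:R)]lnK //.
  by have := expR_ge0 (ln 9 * (1 + k) / k); lra.
have hP2 : ln 9 * (1 + k) <= k * ln (P%:R : R).
  rewrite [leRHS]mulrC -ler_pdivrMr // -ler_expR [expR (ln P%:R)]lnK //.
  by have := expR_ge0 (ln (16 / e) + 1); lra.
pose q := (\prod_(p <- ps) p)%N.
have Pq : (P ^ m <= q)%N.
  rewrite -sps /q; elim: (ps) bps => [|p l IHl] /=; first by rewrite big_nil.
  by move=> /andP[/andP[h1 _] h2]; rewrite big_cons expnS leq_mul ?IHl.
have q1 : (4 <= q)%N.
  apply: leq_trans Pq; apply: (@leq_trans P); first exact: leq_trans BP.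
  by rewrite expnS leq_pmulr // expn_gt0 ltnW.
have lPq : m%:R * ln P%:R <= ln (q%:R : R).
  have -> : m%:R * ln P%:R = ln ((P ^ m)%:R : R) by rewrite natrX lnXn // mulr_natl.
  by rewrite ler_ln ?posrE ?ltr0n ?expn_gt0 ?(ltnW P1) ?ler_nat // (leq_trans _ q1).
have lP0 : 0 <= ln (P%:R : R) by apply: ln_nat_ge0; apply: ltnW.
have Ps : 1 <= (P%:R : R) by rewrite (ler_nat R 1) ltnW.
have ps0 : all (fun p => 0 < p)%N ps.
  by apply: sub_all bps => p /andP[h _]; apply: leq_trans h; apply: ltnW.
have pss : all (fun p => Num.sqrt p%:R <= P%:R :> R) ps.
  apply: sub_all bps => p /andP[_ h].
  have -> : P%:R = Num.sqrt ((P ^ 2)%:R : R) by rewrite natrX sqrtr_sqr ger0_norm.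
  by rewrite ler_sqrt // ler_nat.
have [H0 [F0 [theta [f c0 thD thI]]]] := digit_group Ps ps0 pss cops.
have r2 : (2 * (q %/ 2) <= q <= 3 * (q %/ 2))%N.
  rewrite [X in (X <= _)%N]mulnC leq_trunc_div {1}(divn_eq q 2) (mulnC _ 2) (mulnDl 2 1) mul1n.
  rewrite leq_add2l (@leq_trans 1) ?leq_divRL ?(leq_trans _ q1) //.
  by rewrite -ltnS ltn_mod.
exists P%:R, (Num.min k (ln 9 / ln q%:R)), (ln 5 + 4 * ln P%:R), q, (q %/ 2)%N, m, H0, F0, theta.
have q1' : (1 < q)%N by apply: leq_trans q1.
have lq0 : 0 < ln (q%:R : R) by rewrite ln_gt0 // ltr1n.
split=> //.
- split=> //; last lra.
  by rewrite lt_min k0 divr_gt0.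
- by split=> //; rewrite leq_divRL.
- by rewrite -sps.
move=> K X T X0 tT; apply: approximable_toep tT => //.
- by rewrite eta0.
- exact: ltnW.
- apply: (le_trans hP2); rewrite ler_wpM2l ?(ltW k0) //.
  apply: le_trans lPq; rewrite ler_peMl // (ler_nat R 1) //.
Qed.

End LargeCyclic.

(** * Decomposition of a finite abelian group *)

Section Decomposition.
Variable R : realType.
Local Notation C := R[i].
Variables (s s' : R) (m q r : nat) (H0 : finZmodType) (F0 : H0 -> H0 -> C)
  (theta : nat -> H0).
Hypotheses (s1 : 1 <= s) (r1 : (1 < r)%N) (rq : (2 * r <= q <= 3 * r)%N)
  (f0 : fsys s m F0) (c0 : #|H0| = q)
  (thD : forall a b, theta (a + b)%N = theta a + theta b)
  (thI : forall a b, theta a = theta b -> a = b %[mod q])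
  (s'1 : 1 <= s') (rs' : Num.sqrt (r ^ r)%:R <= s').

(* Small cyclic factors are collected in [Hs]; the larger ones in [Xb], where the
   chirp [u] leaves a Toeplitz kernel. *)
Definition decomposable (X : finType) (K : X -> X -> C) : Prop :=
  exists n (Hs : finZmodType) (Fs : Hs -> Hs -> C) k (Xb : finType)
      (T : Xb -> Xb -> C) (u : Xb -> C) (iota : X -> Hs * Xb),
    [/\ fsys s' n Fs /\ (2 ^ n <= #|Hs| <= (r ^ r) ^ n)%N,
        toep s m q k T, (forall x, nc (u x) = 1),
        injective iota /\ #|X| = (#|Hs| * #|Xb|)%N
      & forall x y, K x y =
          tens Fs (fun a b => u a * T a b * u b) (iota x) (iota y)].

Lemma decomposable_unit : decomposable (fun _ _ : 'I_1 => 1).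
Proof.
exists 0%N, 'I_1, (fun _ _ => 1), 0%N, 'I_1, (fun _ _ => 1), (fun=> 1), (fun x => (x, x)).
split=> //.
- by split; [exact: fsys_unit|rewrite card_ord].
- exact: toep_unit.
- by move=> x; rewrite nc1.
- by split; [move=> x y []|rewrite card_ord].
- by move=> x y; rewrite /tens !mulr1.
Qed.

Lemma decomposable_cyclic p (X : finType) (K : X -> X -> C) : (0 < p)%N ->
  decomposable K -> decomposable (tens (@zkern R p) K).
Proof.
move=> p0 [n [Hs [Fs [k [Xb [T [u [io [[fs /andP[hn1 hn2]] tT nu [ioI cX] KE]]]]]]]]].
(* A factor of order at most [r ^ r] joins [Hs]; a larger one becomes Toeplitz and joins [Xb]. *)
have [sm|la] := leqP p.+1 (r ^ r).
  exists n.+1, ('I_p.+1 * Hs)%type, (tens (@zkern R p) Fs), k, Xb, T, u,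
    (fun x => ((x.1, (io x.2).1), (io x.2).2)); split=> //.
  - split.
      rewrite -add1n; apply: fsys_tens fs; first by apply: le_trans s'1.
      apply: fsys_cyclic => //; apply: le_trans rs'.
      by rewrite ler_sqrt ?ler0n // ler_nat.
    by rewrite card_prod card_ord !expnS !leq_mul.
  - split; last by rewrite !card_prod cX mulnA.
    move=> [i x] [j y] [-> h1 h2]; congr pair; apply: ioI.
    by case: (io x) (io y) h1 h2 => a b [a' b'] /= -> ->.
  - by move=> x y; rewrite {1}/tens KE /tens /= !mulrA.
have s0 : 0 <= s by apply: le_trans s1.
have [k' [u' [T' [tT' nu' zE]]]] := zkern_toep s0 r1 rq f0 c0 thD thI la.
exists n, Hs, Fs, (k' + k)%N, ('I_p.+1 * Xb)%type, (tens T' T), (fun x => u' x.1 * u x.2),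
  (fun x => ((io x.2).1, (x.1, (io x.2).2))); split=> //.
- by split=> //; rewrite hn1.
- exact: toep_tens.
- by move=> x; rewrite Normc.normcM nu' nu mulr1.
- split; last by rewrite !card_prod cX mulnCA.
  move=> [i x] [j y] [h1 -> h2]; congr pair; apply: ioI.
  by case: (io x) (io y) h1 h2 => a b [a' b'] /= -> ->.
- by move=> x y; rewrite {1}/tens KE zE /tens /=; ring.
Qed.

(** Induction on the cyclic factors. A character is determined by its values at the generators,
    which are roots of unity, so it is a column of the tensor product. *)
Lemma decomposable_group (gT : finGroupType) (l : seq gT) (H : {group gT}) :
  \big[dprod/1%g]_(x <- l) <[x]>%g = H -> all (fun x => 1 < #[x]%g)%N l ->
  exists (X : finType) (K : X -> X -> C) (f : X -> gT),
    [/\ decomposable K, #|X| = #|H|, forall h, h \in H -> exists x, h = f x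
      & forall chi : gT -> C, chi 1%g = 1 ->
          (forall g h, chi (g * h)%g = chi g * chi h) ->
          exists y, forall x, chi (f x) = K x y].
Proof.
elim: l H => [|g l IHl] H.
  rewrite big_nil => <- _; exists 'I_1, (fun _ _ => 1), (fun=> 1%g); split.
  - exact: decomposable_unit.
  - by rewrite card_ord cards1.
  - by move=> h /set1P ->; exists ord0.
  - by move=> chi chi1 _; exists ord0 => x.
rewrite big_cons => defH /= /andP[og ol].
have [[_ L _ defL] _ _ _] := dprodP defH; rewrite defL in defH.
have [X [K [f [dK cX fX chiX]]]] := IHl L defL ol.
have [p op] : exists p, #[g]%g = p.+1 by exists (#[g]%g).-1; rewrite prednK.
exists ('I_p.+1 * X)%type, (tens (@zkern R p) K),
  (fun x : 'I_p.+1 * X => (g ^+ (x.1 : nat) * f x.2)%g); split.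
- by apply: decomposable_cyclic dK; rewrite -ltnS -op.
- by rewrite card_prod card_ord cX -op -(dprod_card defH).
- move=> h /(mem_dprod defH) [y [z [/cyclePmin[i ig ->] /fX[x ->] -> _]]].
  by rewrite op in ig; exists (Ordinal ig, x).
move=> chi chi1 chiM; have [y hy] := chiX chi chi1 chiM.
have chiXn n : chi (g ^+ n)%g = chi g ^+ n.
  by elim: n => [|n IHn]; rewrite ?expg0 // expgS chiM IHn exprS.
have [j hj] : {j : 'I_p.+1 | chi g = e2pi p.+1%:R^-1 ^+ j}.
  by apply: (prim_rootP (e2pi_prim R p)); rewrite -op -chiXn expg_order.
exists (j, y) => x; rewrite chiM hy chiXn hj /tens /= /zkern -exprM mulnC //.
Qed.

End Decomposition.

Import FinRing.Theory.

(** * The exponential as a faithful character of R/Z *)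

Section Characters.
Variable R : realType.
Local Notation C := R[i].

Lemma exp2pii_pi (t : R) : exp2pii (\pi_(RmodZ R)%qT t) = e2pi t.
Proof. exact: exp2piiE. Qed.

Lemma exp2piiD (x y : RmodZ R) : exp2pii (x + y) = exp2pii x * exp2pii y.
Proof.
rewrite -[x]reprK -[y]reprK.
have -> : (\pi_(RmodZ R)%qT (repr x) + \pi_(RmodZ R)%qT (repr y) : RmodZ R)
   = \pi_(RmodZ R)%qT (repr x + repr y) by rewrite Quotient.pi_add.
by rewrite !exp2pii_pi e2piD.
Qed.

Lemma pi_RmodZ0 : \pi_(RmodZ R)%qT 0 = 0 :> RmodZ R.
Proof.
apply: (addrI (\pi_(RmodZ R)%qT 0)); rewrite addr0.
by rewrite -[LHS]Quotient.pi_add addr0.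
Qed.

Lemma exp2pii0 : exp2pii (0 : RmodZ R) = 1.
Proof. by rewrite -pi_RmodZ0 exp2pii_pi e2pi0. Qed.

(** Subtracting the floor of a representative leaves a number in [0, 1), where [e2pi] takes the
    value 1 only at 0. *)
Lemma exp2pii_eq1 (x : RmodZ R) : exp2pii x = 1 -> x = 0.
Proof.
rewrite -[x]reprK exp2pii_pi; set t := repr x.
have /andP[t0 t1] := floor_itv t; set n := Num.floor t in t0 t1.
have en : e2pi (n%:~R : R) = 1.
  case: (n) => k; first by rewrite -pmulrn e2pi_nat.
  by rewrite NegzE mulrNz e2piN -pmulrn e2pi_nat; exact: rmorph1.
have -> : t = (t - n%:~R) + n%:~R by rewrite subrK.
rewrite e2piD en mulr1 => h.
have tn : t = n%:~R.
  apply/eqP; rewrite eq_le t0 andbT leNgt; apply/negP => lt.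
  have : 0 < t - n%:~R < 1 by rewrite subr_gt0 lt ltrBlDr addrC -[1]/(1%:~R) -intrD.
  by move=> /e2pi_neq1; rewrite h eqxx.
rewrite tn subrr add0r -pi_RmodZ0; apply/eqP.
by rewrite -Quotient.idealrBE subr0; exact: intr_int.
Qed.

End Characters.

(** * From kernels to matrices, and the conclusion *)

Section Main.
Variable R : realType.
Local Notation C := R[i].

Lemma rk_le_mxrank (X : finType) (K : X -> X -> C) (r : R) : rk_le K r ->
  (\rank (\matrix_(i < #|X|, j < #|X|) K (enum_val i) (enum_val j)))%:R <= r.
Proof.
move=> [Z [u [v [hZ KE]]]]; apply: le_trans hZ; rewrite ler_nat.
pose U : 'M[C]_(#|X|, #|Z|) := \matrix_(i, k) u (enum_val i) (enum_val k).
pose V : 'M[C]_(#|Z|, #|X|) := \matrix_(k, j) v (enum_val k) (enum_val j).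
rewrite (_ : \matrix_(i, j) _ = U *m V) ?mulmx_max_rank //.
apply/matrixP => i j; rewrite !mxE KE /kmul (big_enum_val (A := Z)) /=.
by apply: eq_bigr => k _; rewrite !mxE.
Qed.

Lemma nrm_le_norm_1oo (X : finType) (E : X -> X -> C) (c : R) : 0 <= c -> nrm_le E c ->
  norm_1oo (\matrix_(i < #|X|, j < #|X|) E (enum_val i) (enum_val j)) <= c.
Proof.
move=> c0 [h _]; apply: bigmax_le => // i _.
under eq_bigr do rewrite mxE.
by have := h (enum_val i); rewrite (big_enum_val (A := X)).
Qed.

(** Both factors are given the weaker saving and the larger constant before tensoring. The chirps
    have modulus 1, so they preserve rank and norm bounds. *)
Lemma approximable_decomposable (s s' : R) m q r (eta a c a' c' : R) (X : finType)
    (K : X -> X -> C) :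
  0 < eta <= 2^-1 -> 0 < a -> 0 <= c -> 0 < a' -> 0 <= c' -> (0 < #|X|)%N ->
  (forall k (Y : finType) (T : Y -> Y -> C), (0 < #|Y|)%N ->
     toep s m q k T -> approximable eta a c T) ->
  (forall n (H : finZmodType) (F : H -> H -> C), fsys s' n F ->
     (2 ^ n <= #|H| <= (r ^ r) ^ n)%N -> approximable eta a' c' F) ->
  decomposable s s' m q r K ->
  approximable (2 * eta) (Num.min a a' * eta) (2 * Num.max c c' + ln 2) K.
Proof.
move=> heta a0 c0 a'0 c'0 X0 gT gF [n [Hs [Fs [k [Xb [T [u [io [[fs hn] tT nu [ioI cX] KE]]]]]]]]].
have /andP[Hs0 Xb0] : (0 < #|Hs|)%N && (0 < #|Xb|)%N by rewrite -muln_gt0 -cX.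
have g1 : approximable eta (Num.min a a') (Num.max c c') Fs.
  by apply: approximableW (gF _ _ _ fs hn) => //; rewrite ?ge_min ?le_max lexx ?orbT.
have g2 : approximable eta (Num.min a a') (Num.max c c') (fun x y => u x * T x y * u y).
  apply: (@approximableW _ _ a c); rewrite ?ge_min ?le_max ?lexx //.
  have [E [h1 h2]] := gT _ _ _ Xb0 tT.
  exists (fun x y => u x * E x y * u y); split; last exact: nrm_le_scale h2.
  by apply: eq_rk (rk_le_scale u u h1) => x y; ring.
have T1 x y : nc (u x * T x y * u y) <= 1.
  have [H [F [phi [g [_ _ _ gb [TE _]]]]]] := tT.
  by rewrite !Normc.normcM !nu mul1r mulr1 TE.
have [E [h1 h2]] : approximable (2 * eta) (Num.min a a' * eta) (2 * Num.max c c' + ln 2)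
    (tens Fs (fun x y => u x * T x y * u y)).
  apply: approximable_tens g1 g2 => //; first by rewrite lt_min a0.
    by rewrite le_max c0.
  by move=> x y; rewrite (fsys_nc fs).
rewrite card_prod -cX in h1 h2.
exists (fun x y => E (io x) (io y)); split; last exact: nrm_le_sub h2.
by apply: eq_rk (rk_le_sub io io h1) => x y; rewrite KE.
Qed.

End Main.

Theorem theorem1p4 (R : realType) (eta : R) (eta_gt0 : 0 < eta) :
  exists (a : R) (N0 : nat), 0 < a /\
    forall (G : finZmodType) (b : G -> G -> RmodZ R),
      nondeg_sym_pairing b -> (N0 <= #|G|)%N ->
      exists B : 'M[R[i]]_#|G|,
        (\rank B)%:R <= #|G|%:R `^ (1 - a) /\
        norm_1oo (fourier_mx b - B) <= #|G|%:R `^ (2^-1 + eta).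
Proof.
(* Tensoring doubles [h], so the norm exponent exceeds 1/2 by at most [eta / 2]; the other half
   absorbs constants. *)
pose h := Num.min 2^-1 (eta / 4).
have h0 : 0 < h by rewrite lt_min invr_gt0 ltr0n divr_gt0.
have h1 : h <= 2^-1 by rewrite ge_min lexx.
have h2 : h <= eta / 4 by rewrite ge_min lexx orbT.
have h01 : 0 < h <= 1 by rewrite h0; lra.
have [s [a [c [q [r [m [H0 [F0 [theta [[s1 a0 c0] [r1 rq] [f0 cH0] [thD thI] gT]]]]]]]]]]
  := large_cyclic_parameters h01.
have rr1 : (1 < r ^ r)%N by rewrite -{1}(expn0 r) ltn_exp2l // ltnW.
pose s' := Num.sqrt (r ^ r)%:R : R.
have s'1 : 1 <= s' by rewrite -[leLHS]sqrtr1 ler_sqrt // (ler_nat R 1) ltnW.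
have [a' [c' [a'0 c'0 gF]]] := approximable_fsys s'1 h0 rr1.
pose A := Num.min a a' * h; pose c1 := 2 * Num.max c c' + ln 2.
have A0 : 0 < A by rewrite mulr_gt0 // lt_min a0.
(* For [ln #|G| >= c1 / d] the constant [c1] costs at most half of the saving [A] and half of
   [eta]. *)
pose d := Num.min (A / 2) (eta / 2).
have d0 : 0 < d by rewrite lt_min !divr_gt0.
exists (A / 2), (Num.trunc (expR (c1 / d))).+1; split; first by rewrite divr_gt0.
move=> G b [bDl bDr bC b0] hG.
have G0 : (0 < #|G|)%N by apply: leq_trans hG.
have b0l y : b 0 y = 0 by apply: (addrI (b 0 y)); rewrite -bDl !addr0.
have [l defG al] := abelian_structure (zmod_abelian [set: G]%G).
have ol : all (fun x : G => 1 < #[x]%g)%N l.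
  by have := abelian_type_gt1 [set: G]; rewrite -al all_map.
have [X [K [f [dK cX fX chiX]]]] :=
  decomposable_group s1 r1 rq f0 cH0 thD thI s'1 (lexx s') (H := [set: G]%G) defG ol.
rewrite cardsT in cX.
have fE g : exists x, f x == g by have [x ->] := fX g (finset.in_setT _); exists x.
pose f' g := xchoose (fE g); have f'K : cancel f' f.
  by move=> g; apply/eqP; exact: xchooseP (fE g).
(* Each [exp2pii (b _ y)] is a character, hence a column of [K]. Together with the section [f'] of
   [f] this exhibits the Fourier matrix as a submatrix of [K]. *)
have tauE y : exists t, [forall x, exp2pii (b (f x) y) == K x t].
  have [||t ht] := chiX (fun x => exp2pii (b x y)).
  - by rewrite zmod1gE b0l exp2pii0.
  - by move=> x z; rewrite zmodMgE bDl exp2piiD.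
  by exists t; apply/forallP => x; rewrite ht.
pose tau y := xchoose (tauE y).
have tauP g y : exp2pii (b g y) = K (f' g) (tau y).
  have /forallP/(_ (f' g))/eqP <- := xchooseP (tauE y).
  by rewrite f'K.
(* Equal columns would make [b x (y - z)] vanish for all [x], against nondegeneracy. Injectivity is
   needed to restrict the norm bound. *)
have tauI : injective tau.
  move=> y z yz; apply/eqP; rewrite -subr_eq0; apply/eqP/b0 => x.
  rewrite bC; apply: exp2pii_eq1.
  have nz : exp2pii (b x z) != 0.
    by apply/eqP => e0; have := exp2pii_pi (repr (b x z)); rewrite reprK e0 => E0;
      have := nc_e2pi (repr (b x z)); rewrite -E0 Normc.normc0 => /eqP; rewrite eq_sym oner_eq0.
  by apply: (mulIf nz); rewrite -exp2piiD -bDr subrK mul1r !tauP yz.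
have X0 : (0 < #|X|)%N by rewrite cX.
have hh : 0 < h <= 2^-1 by rewrite h0.
have [E [hE1 hE2]] := approximable_decomposable hh a0 c0 a'0 c'0 X0 gT gF dK.
rewrite -/A -/c1 cX in hE1 hE2.
have L : c1 / d <= ln #|G|%:R.
  rewrite -ler_expR [leRHS]lnK ?posrE ?ltr0n //; apply: ltW.
  by apply: lt_le_trans (truncnS_gt _) _; rewrite ler_nat.
have Lge0 : 0 <= ln (#|G|%:R : R) by apply: ln_nat_ge0.
rewrite ler_pdivrMr // in L.
have powE x : #|G|%:R `^ x = expR (x * ln #|G|%:R) :> R.
  by rewrite mulrC expRM lnK // posrE ltr0n.
have L1 : c1 <= A / 2 * ln #|G|%:R.
  by apply: (le_trans L); rewrite mulrC ler_wpM2r // ge_min lexx.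
have L2 : c1 <= eta / 2 * ln #|G|%:R.
  by apply: (le_trans L); rewrite mulrC ler_wpM2r // ge_min lexx orbT.
pose EG g y := E (f' g) (tau y).
(* The low-rank matrix is the Fourier matrix minus [EG], so the remainder is exactly [EG]. *)
exists (\matrix_(i, j) (exp2pii (b (enum_val i) (enum_val j)) - EG (enum_val i) (enum_val j))).
split.
  apply: le_trans (rk_le_mxrank (K := fun g y => exp2pii (b g y) - EG g y) (r := _) _) _.
    by apply: eq_rk (rk_le_sub f' tau hE1) => g y; rewrite tauP.
  rewrite powE ler_expR; lra.
rewrite (_ : _ - _ = \matrix_(i, j) EG (enum_val i) (enum_val j)); last first.
  by apply/matrixP => i j; rewrite !mxE opprB addrCA subrr addr0.
rewrite powE; apply: nrm_le_norm_1oo; first exact: expR_ge0.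
apply: nrm_leW (nrm_le_sub (can_inj f'K) tauI hE2).
rewrite ler_expR; have := ler_wpM2r Lge0 h2; lra.
Qed.
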